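(* Let $N\ge 1$ be an integer and let $p,b,q$ be real numbers with $$1<p<N,\qquad -1\le b\le 0,\qquad q>q^{\ast}=\frac{Np}{N-p-pb}>1.$$ Then the variational problem $$S:=\inf\Big\{\|u\|_{D^{1,p}}^p:\ u\in D_0^{1,p}(\mathbb{Z}^N),\ \|u\|_{\ell_b^q}=1\Big\}$$ admits a minimizer, i.e. there is $u\in D_0^{1,p}(\mathbb{Z}^N)$ with $\|u\|_{\ell_b^q}=1$ and $\|u\|_{D^{1,p}}^p=S$.
   Context: $\mathbb{Z}^N$ denotes the integer lattice graph: the vertices are the points of $\mathbb{Z}^N$, and $x\sim y$ (neighbors) iff $\sum_{i=1}^N|x_i-y_i|=1$. Let $d(x)$ be the combinatorial (graph) distance from $x$ to the origin. For $s\in\mathbb{R}$ define the weight $\mu_s(x)=(1+d(x))^s$ on $\mathbb{Z}^N$. For a function $u$ on $\mathbb{Z}^N$, $\|u\|_{\ell_b^q}=\big(\sum_{x\in\mathbb{Z}^N}\mu_{bq}(x)|u(x)|^q\big)^{1/q}$ and $\|u\|_{D^{1,p}}=\big(\sum_{x\in\mathbb{Z}^N}\sum_{y\sim x}|u(y)-u(x)|^p\big)^{1/p}$. The space $D_0^{1,p}(\mathbb{Z}^N)$ is the completion of the space of finitely supported functions on $\mathbb{Z}^N$ in the norm $\|\cdot\|_{D^{1,p}}$. *)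

(* Defs.v *)
From HB Require Import structures.
From mathcomp Require Import all_boot all_order all_algebra.
From mathcomp Require Import all_classical all_reals all_analysis.

Set Implicit Arguments.
Unset Strict Implicit.
Unset Printing Implicit Defensive.

Import Order.TTheory GRing.Theory Num.Theory.
Import numFieldNormedType.Exports.

Local Open Scope classical_set_scope.
Local Open Scope ring_scope.

Notation lattice N := 'rV[int]_N.

Definition adj (N : nat) (x y : lattice N) : bool :=
  \sum_(i < N) `|x ord0 i - y ord0 i| == 1.

Definition is_walk (N : nat) (x y : lattice N) (s : seq (lattice N)) : bool :=
  path (@adj N) x s && (last x s == y).

Lemma lattice_connected (N : nat) (x : lattice N) :
  exists n : nat, `[< exists2 s, is_walk 0 x s & size s = n >].
Proof.
suff [s sP] : exists s, is_walk 0 x s.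
  by exists (size s); apply/asboolP; exists s.
have [n] := ubnP (\sum_(i < N) `|x ord0 i|%N)%N.
elim: n x => // n IHn x; rewrite ltnS => len.
have [->|/rV0Pn[i xi0]] := eqVneq x 0; first by exists [::]; rewrite /is_walk /=.
pose y := x - sgz (x ord0 i) *: delta_mx ord0 i.
have yE j : y ord0 j = x ord0 j - (if j == i then sgz (x ord0 i) else 0).
  by rewrite !mxE eqxx /=; case: eqP => _; rewrite ?mulr1 ?mulr0.
have [|s /andP[ps /eqP ls]] := IHn y.
  apply: leq_trans len; rewrite (bigD1 i) //= [ltnRHS](bigD1 i) //= -addSn.
  apply: leq_add; last first.
    by apply: leq_sum => j ji; rewrite yE (negbTE ji) subr0.
  rewrite yE eqxx; move: xi0; case: (x ord0 i) => [[|k]|k] //= _.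
    by rewrite subSS subn0.
  rewrite /sgz -[(Negz k < 0)%R]/true NegzE intS /=.
  by rewrite opprK opprD addrAC addNr add0r abszN.
exists (rcons s x); rewrite /is_walk rcons_path ps ls last_rcons eqxx andbT /=.
rewrite /adj (bigD1 i) //= big1 => [|j ji]; last first.
  by rewrite yE (negbTE ji) subr0 subrr normr0.
by rewrite yE eqxx addr0 addrAC subrr add0r normrN normr_sgz xi0.
Qed.

Definition dist0 (N : nat) (x : lattice N) : nat := ex_minn (lattice_connected x).

Section Spaces.
Context {R : realType} {N : nat}.
Implicit Types (p b q s : R) (u : lattice N -> R).

Definition weight s (x : lattice N) : R := (1 + (dist0 x)%:R) `^ s.

Definition norm_lbq b q u : \bar R :=
  ((\esum_(x in [set: lattice N]) (weight (b * q) x * `|u x| `^ q)%:E)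
    `^ q^-1)%E.

Definition norm_D1p p u : \bar R :=
  ((\esum_(x in [set: lattice N]) \esum_(y in [set y | adj x y])
      (`|u y - u x| `^ p)%:E) `^ p^-1)%E.

Definition finitely_supported u : Prop := finite_set [set x | u x != 0].

(* The completion of the finitely supported functions, realized as a space of
   functions: for p < N the D^{1,p}-norm controls point values of finitely
   supported functions (Sobolev), so Cauchy sequences converge pointwise and
   the limit function determines the class. Pointwise convergence
   cannot be dropped, since norm_D1p vanishes on constants. *)
Definition D0_1p p : set (lattice N -> R) :=
  [set u | exists phi : nat -> lattice N -> R,
    [/\ forall n, finitely_supported (phi n),
        norm_D1p p (phi n \- u) @[n --> \oo] --> 0%:E
      & forall x, phi n x @[n --> \oo] --> u x]].

Definition minimal_energy p b q : \bar R :=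
  ereal_inf [set (norm_D1p p u `^ p)%E |
    u in [set u | D0_1p p u /\ norm_lbq b q u = 1%E]].

End Spaces.

Definition qstar (R : realType) (N : nat) (p b : R) : R :=
  N%:R * p / (N%:R - p - p * b).

(* Main.v *)
Require Import Defs.
From mathcomp Require Import all_boot all_order all_algebra.
From mathcomp Require Import all_classical all_reals all_analysis.
From mathcomp Require Import finmap zify ring lra.

Set Implicit Arguments.
Unset Strict Implicit.
Unset Printing Implicit Defensive.

Import Order.TTheory GRing.Theory Num.Theory.
Import numFieldNormedType.Exports.

Local Open Scope classical_set_scope.
Local Open Scope ring_scope.

(** Notation for this comment: [E u] is the energy, the sum of
[|u y - u x| ^ p] over ordered pairs of neighbours; [Q u] is the sum of
[(1 + d) ^ (b q) |u| ^ q]; [S] is the infimum of [E] on [Q u = 1]; and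
[p* = N p / (N - p)].

Everything rests on the Sobolev inequality bounding the [l^r] norm by the energy
for every [r > p*] ([sobolev_supercritical]). Staying away from [p*] itself makes
it elementary. Average [u] successively over cubes of side [2 ^ k], starting from
[u] itself at [k = 0]. By Poincare's inequality the
[k]-th difference [D_k] has [l^p] norm at most [C 2 ^ k] times the norm of the
gradient; since [D_k] is itself an average over a cube of side [2 ^ k], its
supremum gains a further factor [2 ^ (- k N / p)]. Interpolating between [l^p] and
[l^oo] bounds the [l^r] norms of the [D_k] by a geometric series exactly when
[r > p*].

Consequently [D_0^{1,p}] is the space of functions with finite energy lying in
[l^r] ([D0_1pP]): conversely, such a function tends to 0 at infinity, so cutting
it off at small heights gives finitely supported approximations. In this form the
space is visibly stable under pointwise limits with bounded energy, translations
and differences.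

Take a minimizing sequence [u_n]. It does not vanish in the limit
([nonvanishing]). When [b = 0], [Q u <= sup |u| ^ (q - r) sum |u| ^ r] with
[p* < r < q] forces a value bounded below, which a translation moves to the
origin. When [b < 0], the condition [q > q*] says precisely that Hoelder's
inequality against some [l^r], [r > p*], still leaves a negative power of the
distance to spare, so a fixed ball carries mass. Let [u] be the pointwise limit
along an ultrafilter and [th = Q u], so [0 < th <= 1]. By the Brezis-Lieb
splitting ([mass_loss_le]), the remainders [v_n = u_n - u] satisfy
[lim Q v_n >= 1 - th] and [lim E v_n <= S - E u]. As [E v >= S (Q v) ^ (p / q)]
by homogeneity,

  [E u <= S (1 - (1 - th) ^ (p / q)) <= S th ^ (p / q)],

the last step because [p <= q]. So [th ^ (- 1 / q) u] satisfies the constraint and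
has energy at most [S]: it is a minimizer. *)

(** * Convexity of powers *)

Section PowerInequalities.
Context {R : realType}.
Implicit Types p s t a b : R.

Lemma ler_powR_base p a b : 0 <= p -> 0 <= a -> a <= b -> a `^ p <= b `^ p.
Proof.
move=> p0 a0 ab; apply: ge0_ler_powR => //; rewrite nnegrE //.
exact: le_trans ab.
Qed.

Lemma powR_cancel p a : p != 0 -> 0 <= a -> (a `^ p^-1) `^ p = a.
Proof. by move=> p0 a0; rewrite -powRrM mulVf // powRr1. Qed.

Lemma powRD_gt0 (x a b : R) : 0 < x -> x `^ (a + b) = x `^ a * x `^ b.
Proof. by move=> x0; rewrite powRD // (gt_eqF x0) implybT. Qed.

Lemma powR_gt1 (x a : R) : 1 < x -> 0 < a -> 1 < x `^ a.
Proof.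
move=> x1 a0; have x0 : 0 < x by apply: lt_trans x1.
have := @gt0_ltr_powR R _ a0 1 x; rewrite !nnegrE ltW // (ltW x0) powR1.
exact.
Qed.

(** Convexity of [x |-> x ^ p] between the points [|a| / l] and [|b| / (1 - l)],
where [l = s / (s + t)]. *)
Lemma powR_normD p s t a b : 1 <= p -> 0 < s -> 0 < t ->
  `|a + b| `^ p <= (s + t) `^ (p - 1) *
    (s `^ (1 - p) * `|a| `^ p + t `^ (1 - p) * `|b| `^ p).
Proof.
move=> p1 s0 t0.
have st0 : 0 < s + t by rewrite addr_gt0.
have p0 : 0 <= p by apply: le_trans p1.
pose l := s / (s + t).
have l0 : 0 < l by rewrite divr_gt0.
have l1 : 1 - l = t / (s + t) by rewrite /l; field; rewrite gt_eqF.
have m0 : 0 < 1 - l by rewrite l1 divr_gt0.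
have cv (x y : R) : 0 <= x -> 0 <= y ->
    (l * x + (1 - l) * y) `^ p <= l * x `^ p + (1 - l) * y `^ p.
  move=> x0 y0.
  have l01 : 0 <= l by exact: ltW.
  have l11 : l <= 1 by rewrite -subr_ge0 ltW.
  have := @convex_powR R p p1 (Itv01 l01 l11) x y.
  by apply; apply/mem_set; rewrite /= in_itv /= ?x0 ?y0.
apply: (@le_trans _ _ ((l * (`|a| / l) + (1 - l) * (`|b| / (1 - l))) `^ p)).
  apply: ler_powR_base => //.
  by rewrite !(mulrCA _ `|_|) !divff ?gt_eqF // !mulr1 ler_normD.
have s0' := ltW s0; have t0' := ltW t0; have st0' := ltW st0.
have l0' := ltW l0; have m0' := ltW m0.
apply: le_trans (cv _ _ _ _) _; rewrite ?divr_ge0 //.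
have E (x y : R) : 0 < x -> 0 <= y -> x * (y / x) `^ p = x `^ (1 - p) * y `^ p.
  move=> x0 y0; have x0' := ltW x0; rewrite powRM ?invr_ge0 //.
  rewrite -[x^-1]powR_inv1 // -powRrM mulN1r [y `^ p * _]mulrC mulrA.
  congr (_ * _).
  by rewrite -{1}[x]powRr1 // -powRD_gt0.
rewrite !E // l1 /l !powRM ?invr_ge0 //.
rewrite -[(s + t)^-1]powR_inv1 // -!powRrM mulN1r opprB.
by rewrite mulrDr !mulrA ![(s + t) `^ _ * _]mulrC.
Qed.

(** Jensen's inequality for [x |-> x ^ p] with free weights: a geometric choice
of [w] controls series, and [w = 1] controls averages. *)
Lemma powR_norm_sum (I : Type) (r : seq I) (w a : I -> R) p : 1 <= p ->
  (forall i, 0 < w i) ->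
  `|\sum_(i <- r) a i| `^ p <=
  (\sum_(i <- r) w i) `^ (p - 1) *
  \sum_(i <- r) (w i) `^ (1 - p) * `|a i| `^ p.
Proof.
move=> p1 w0; have p0 : p != 0 by rewrite gt_eqF // (lt_le_trans _ p1).
have sw0 (s : seq I) : 0 <= \sum_(i <- s) w i by apply: sumr_ge0 => i _; exact: ltW.
elim: r => [|i r IH]; first by rewrite !big_nil mulr0 normr0 powR0.
rewrite !big_cons; have := sw0 r; rewrite le_eqVlt => /predU1P[r0|r0].
  case: r r0 {IH} => [_|j r]; last first.
    by move=> /eqP; rewrite [X in _ == X]big_cons lt_eqF // ltr_wpDr.
  rewrite !big_nil !addr0 mulrA -powRD_gt0 //.
  by rewrite addrA subrK subrr powRr0 mul1r.
apply: le_trans (powR_normD _ _ p1 (w0 i) r0) _.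
rewrite ler_wpM2l ?powR_ge0 // lerD2l.
apply: le_trans (ler_wpM2l (powR_ge0 _ _) IH) _.
rewrite mulrA -powRD_gt0 //.
by rewrite addrA subrK subrr powRr0 mul1r.
Qed.

Lemma powR_norm_avg (I : finType) (a : I -> R) p : 1 <= p ->
  `|#|I|%:R^-1 * \sum_i a i| `^ p <= #|I|%:R^-1 * \sum_i `|a i| `^ p.
Proof.
move=> p1; have p0 : p != 0 by rewrite gt_eqF // (lt_le_trans _ p1).
case: (posnP #|I|) => [I0|I0].
  by rewrite !I0 invr0 !mul0r normr0 powR0.
have I0' : 0 < #|I|%:R :> R by rewrite ltr0n.
have I1 : 0 <= #|I|%:R :> R by rewrite ler0n.
rewrite normrM powRM // (@ger0_norm _ #|I|%:R^-1) ?invr_ge0 //.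
have := @powR_norm_sum I (index_enum I) (fun=> 1) a p p1 (fun=> ltr01).
under [X in _ * X]eq_bigr do rewrite powR1 mul1r.
rewrite sumr_const => /(ler_wpM2l (powR_ge0 (#|I|%:R^-1) p)) /le_trans; apply.
have S0 : 0 <= \sum_i `|a i| `^ p by apply: sumr_ge0 => i _; exact: powR_ge0.
rewrite mulrA ler_wpM2r //.
rewrite -[_^-1]powR_inv1 // -powRrM mulN1r -powRD_gt0 //.
by rewrite addrA addNr add0r.
Qed.

Lemma powR_exprn (a p : R) n : 0 <= a -> (a ^+ n) `^ p = (a `^ p) ^+ n.
Proof.
move=> a0; elim: n => [|n IH]; first by rewrite !expr0 powR1.
by rewrite !exprS powRM ?exprn_ge0 // IH.
Qed.

(** A form of Young's inequality in which the larger of [z] and [v] pays for the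
whole product. *)
Lemma powR_young (z v r s : R) : 0 < s -> s <= r -> 0 <= z -> 0 <= v ->
  z `^ (r - s) * v `^ s <= v `^ r + z `^ r.
Proof.
move=> s0 sr z0 v0; have r0 : 0 < r by apply: lt_le_trans sr.
have H (y : R) : 0 <= y -> y `^ (r - s) * y `^ s = y `^ r.
  rewrite le_eqVlt => /predU1P[<-|y0].
    by rewrite [0 `^ s]powR0 ?gt_eqF // mulr0 powR0 // gt_eqF.
  by rewrite -powRD_gt0 // subrK.
have [zv|vz] := leP z v.
  apply: ler_wpDr; first exact: powR_ge0.
  rewrite -H //; apply: ler_wpM2r; first exact: powR_ge0.
  by apply: ler_powR_base; rewrite ?subr_ge0.
apply: ler_wpDl; first exact: powR_ge0.
rewrite -[leRHS]H //; apply: ler_wpM2l; first exact: powR_ge0.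
by apply: ler_powR_base; rewrite ?(ltW s0) ?(ltW vz).
Qed.

Lemma sum_geometric_le (t : R) n : 0 <= t < 1 ->
  \sum_(k < n) t ^+ k <= (1 - t)^-1.
Proof.
move=> /andP[t0 t1]; have t1' : 0 < 1 - t by rewrite subr_gt0.
rewrite -[leRHS]mul1r ler_pdivlMr // mulrC.
by rewrite -opprB mulNr -subrX1 opprB lerBlDr lerDl exprn_ge0.
Qed.

Lemma continuous_powR_gt0 (p x : R) : 0 < x ->
  {for x, continuous (fun y : R => y `^ p)}.
Proof.
move=> x0; apply/differentiable_continuous/derivable1_diffP/derivable_powR.
by rewrite in_itv/= andbT.
Qed.

Lemma cvg_norm_powR (F : set_system nat) {FF : ProperFilter F} (a : nat -> R)
    (l p : R) : 0 < p -> a n @[n --> F] --> l ->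
  `|a n| `^ p @[n --> F] --> `|l| `^ p.
Proof.
move=> p0 al.
have H : `|a n| @[n --> F] --> `|l| by exact: cvg_norm.
have [l0|l0] := eqVneq l 0; last first.
  have C : {for `|l|, continuous (fun x : R => x `^ p)}.
    by apply: continuous_powR_gt0; rewrite normr_gt0.
  exact: (cvg_comp _ _ H C).
rewrite l0 normr0 in H *; rewrite powR0 ?gt_eqF //.
apply/cvgrPdist_lt => e e0.
have e1 : 0 < e `^ p^-1 by rewrite powR_gt0.
near=> n; rewrite sub0r normrN ger0_norm ?powR_ge0 //.
have -> : e = (e `^ p^-1) `^ p by rewrite powR_cancel ?gt_eqF // ltW.
apply: gt0_ltr_powR; rewrite ?nnegrE ?normr_ge0 ?powR_ge0 //.
near: n; move/cvgrPdist_lt : H => /(_ _ e1); apply: filterS => n.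
by rewrite sub0r normrN normr_id.
Unshelve. all: by end_near. Qed.

Lemma cvg0_norm_powR_le (F : set_system nat)
    {FF : ProperFilter F} (a c : nat -> R) (p : R) : 0 < p ->
  (forall n, `|a n| `^ p <= c n) -> c n @[n --> F] --> 0 ->
  a n @[n --> F] --> 0.
Proof.
move=> p0 ac c0; apply/cvgrPdist_lt => e e0.
have e1 : 0 < e `^ p by rewrite powR_gt0.
move/cvgrPdist_lt : c0 => /(_ _ e1); apply: filterS => n.
rewrite !sub0r !normrN => /(le_lt_trans (ler_norm _))/(le_lt_trans (ac n)) H.
rewrite ltNge; apply/negP => ea; move: H; rewrite ltNge.
by rewrite ler_powR_base ?(ltW e0) ?(ltW p0).
Qed.

End PowerInequalities.

(** Ultrafilters replace the extraction of subsequences: every bounded real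
sequence converges along them. *)
Lemma ultra_bounded_cvg {R : realType} (F : set_system nat)
    {FF : UltraFilter F} (a : nat -> R) (K : R) :
  (forall n, `|a n| <= K) -> exists l : R, a n @[n --> F] --> l.
Proof.
move=> aK; have := @segment_compact R (- K) K.
move=> /(_ (a @ F) _) [|l [_ al]].
  have H : \forall n \near F, `[- K, K]%classic (a n).
    by apply: filterE => n; move: (aK n); rewrite ler_norml /= in_itv.
  exact: H.
exists l => U Ul; have [//|nU] := in_ultra_setVsetC (a @^-1` U) FF.
by have [y [/= nUy Uy]] := al (~` U) U nU Ul.
Qed.

(** * Finite power sums *)

Lemma ler_sum_subset {R : realType} {T : eqType} (F : T -> R) (r s : seq T) :
  (forall x, 0 <= F x) -> uniq r -> uniq s -> {subset r <= s} ->
  \sum_(x <- r) F x <= \sum_(x <- s) F x.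
Proof.
move=> F0 ur us rs; rewrite [leRHS](bigID [in r]) /=.
rewrite (_ : \sum_(x <- s | x \in r) F x = \sum_(x <- r) F x).
  by rewrite lerDl; apply: sumr_ge0.
rewrite -big_filter; apply: perm_big; rewrite uniq_perm ?filter_uniq // => x.
by rewrite mem_filter; apply: andb_idr; exact: rs.
Qed.

Section PowerSums.
Context {R : realType} {T : choiceType}.
Implicit Types (p c : R) (f g : T -> R).

(** Bounding all finite partial sums keeps the estimates in the reals and makes
reindexing and pointwise limits immediate; [pboundE] returns to [esum]. *)
Definition pbound p f c :=
  forall s : seq T, uniq s -> \sum_(x <- s) `|f x| `^ p <= c.

Definition esum_pow p f : \bar R := \esum_(x in [set: T]) (`|f x| `^ p)%:E.

Definition psum p f : R := fine (esum_pow p f).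

Lemma pboundE p f c : pbound p f c <-> (esum_pow p f <= c%:E)%E.
Proof.
split=> [H|H s us].
  apply: ge_ereal_sup => _ [X [finX _] <-].
  by rewrite fsbig_finite //= sumEFin lee_fin; apply: H.
rewrite -lee_fin; apply: le_trans H; rewrite -sumEFin.
apply: esum_ge; exists [set` s]; last by rewrite fsbig_seq.
by split => //; exact: finite_seq.
Qed.

Lemma esum_pow_ge0 p f : (0 <= esum_pow p f)%E.
Proof. by apply: esum_ge0 => x _; rewrite lee_fin powR_ge0. Qed.

Lemma psum_ge0 p f : 0 <= psum p f.
Proof. exact/fine_ge0/esum_pow_ge0. Qed.

Lemma esum_pow_psum p f c : pbound p f c -> esum_pow p f = (psum p f)%:E.
Proof.
move/pboundE => H; rewrite /psum fineK // ge0_fin_numE ?esum_pow_ge0 //.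
exact: le_lt_trans (ltry c).
Qed.

Lemma esum_pow_lty p f : (esum_pow p f < +oo)%E -> pbound p f (psum p f).
Proof.
move=> H; apply/pboundE; rewrite /psum fineK // ge0_fin_numE //.
exact: esum_pow_ge0.
Qed.

Lemma pbound_psum p f c : pbound p f c -> pbound p f (psum p f).
Proof. by move=> H; apply/pboundE; rewrite (esum_pow_psum H). Qed.

Lemma psum_le p f c : pbound p f c -> psum p f <= c.
Proof. by move=> H; rewrite -lee_fin -(esum_pow_psum H); exact/pboundE. Qed.

Lemma pbound_ge0 p f c : pbound p f c -> 0 <= c.
Proof. by move=> /(_ [::] isT); rewrite big_nil. Qed.

Lemma pbound_le p f c d : c <= d -> pbound p f c -> pbound p f d.
Proof. by move=> cd H s us; apply: le_trans (H s us) cd. Qed.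

Lemma pbound_dom p f g c : 0 <= p -> (forall x, `|f x| <= `|g x|) ->
  pbound p g c -> pbound p f c.
Proof.
move=> p0 fg H s us; apply: le_trans (H s us).
by apply: ler_sum => x _; apply: ler_powR_base.
Qed.

Lemma pbound_ext p f g c : f =1 g -> pbound p f c -> pbound p g c.
Proof. by move=> /funext ->. Qed.

Lemma pbound_pt p f c x : pbound p f c -> `|f x| `^ p <= c.
Proof. by move=> /(_ [:: x] isT); rewrite big_seq1. Qed.

Lemma pbound_pt_root p f c x : 0 < p -> pbound p f c -> `|f x| <= c `^ p^-1.
Proof.
move=> p0 /(pbound_pt x) H; rewrite -[leLHS](@powRr1 R) //.
rewrite -[X in _ `^ X](@mulfV _ p) ?gt_eqF // powRrM.
by apply: ler_powR_base; rewrite ?invr_ge0 ?powR_ge0 // ltW.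
Qed.

Lemma pboundD p f g c d s t : 1 <= p -> 0 < s -> 0 < t ->
  pbound p f c -> pbound p g d ->
  pbound p (fun x => f x + g x)
    ((s + t) `^ (p - 1) * (s `^ (1 - p) * c + t `^ (1 - p) * d)).
Proof.
move=> p1 s0 t0 fc gd r ur.
apply: le_trans (ler_sum _ (fun x _ => powR_normD (f x) (g x) p1 s0 t0)) _.
rewrite -mulr_sumr ler_wpM2l ?powR_ge0 // big_split /= -!mulr_sumr.
by apply: lerD; rewrite ler_wpM2l ?powR_ge0 //; [exact: fc|exact: gd].
Qed.

Lemma pboundD_half p f g c d : 1 <= p -> pbound p f c -> pbound p g d ->
  pbound p (fun x => f x + g x) (2 `^ (p - 1) * (c + d)).
Proof.
move=> p1 fc gd; have := pboundD p1 ltr01 ltr01 fc gd.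
by rewrite !powR1 !mul1r.
Qed.

Lemma pboundN p f c : pbound p f c -> pbound p (fun x => - f x) c.
Proof. by move=> H s us; under eq_bigr do rewrite normrN; exact: H. Qed.

Lemma pboundB_half p f g c d : 1 <= p -> pbound p f c -> pbound p g d ->
  pbound p (fun x => f x - g x) (2 `^ (p - 1) * (c + d)).
Proof. by move=> p1 fc /pboundN gd; exact: pboundD_half. Qed.

Lemma pboundZ p f c k : pbound p f c ->
  pbound p (fun x => k * f x) (`|k| `^ p * c).
Proof.
move=> H s us; under eq_bigr do rewrite normrM powRM //.
by rewrite -mulr_sumr ler_wpM2l ?powR_ge0 //; exact: H.
Qed.

Lemma psumZ_le p f c k : pbound p f c ->
  psum p (fun x => k * f x) <= `|k| `^ p * psum p f.
Proof. by move=> /pbound_psum H; apply: psum_le; exact: pboundZ. Qed.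

Lemma pbound_avg (I : finType) (F : I -> T -> R) p c : 1 <= p -> 0 <= c ->
  (forall i, pbound p (F i) c) ->
  pbound p (fun x => #|I|%:R^-1 * \sum_i F i x) c.
Proof.
move=> p1 c0 H s us.
apply: le_trans (ler_sum _ (fun x _ => powR_norm_avg (fun i => F i x) p1)) _.
rewrite -mulr_sumr exchange_big /=.
apply: (@le_trans _ _ (#|I|%:R^-1 * \sum_(i : I) c)).
  by rewrite ler_wpM2l ?invr_ge0 ?ler0n //; apply: ler_sum => i _; exact: H.
rewrite sumr_const; case: (posnP #|I|) => [->|I0]; first by rewrite invr0 mul0r.
by rewrite -[c *+ _]mulr_natl mulKf // pnatr_eq0 -lt0n.
Qed.

Lemma cvg_sum_powR (F : set_system nat) {FF : ProperFilter F} p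
  (f_ : nat -> T -> R) f (s : seq T) : 0 < p ->
  (forall x, f_ n x @[n --> F] --> f x) ->
  \sum_(x <- s) `|f_ n x| `^ p @[n --> F] --> \sum_(x <- s) `|f x| `^ p.
Proof.
move=> p0 fx; elim: s => [|x s IH].
  by under eq_cvg do rewrite big_nil; rewrite big_nil; exact: cvg_cst.
under eq_cvg do rewrite big_cons; rewrite big_cons; apply: cvgD => //.
exact: cvg_norm_powR.
Qed.

(** Fatou's lemma. *)
Lemma pbound_cvg (F : set_system nat) {FF : ProperFilter F} p
  (f_ : nat -> T -> R) f c : 0 < p ->
  (\forall n \near F, pbound p (f_ n) c) ->
  (forall x, f_ n x @[n --> F] --> f x) -> pbound p f c.
Proof.
move=> p0 H fx s us.
have L := @cvg_sum_powR F FF p f_ f s p0 fx.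
apply: (cvgr_to_le L).
by near=> n; apply: (near H n).
Unshelve. all: by end_near. Qed.

Lemma psum_adherent p f c e : pbound p f c -> 0 < e ->
  exists2 s : seq T, uniq s & psum p f - e < \sum_(x <- s) `|f x| `^ p.
Proof.
move=> fc e0; apply: contrapT => /forall2NP H.
suff /psum_le : pbound p f (psum p f - e) by rewrite leNgt ltrBlDr ltrDl e0.
move=> s us; have [//|/negP] := H s.
by rewrite -leNgt.
Qed.

(** The part of a power sum carried by the complement of a finite set [s]. *)
Lemma pbound_tail p f c (s : seq T) : 0 < p -> uniq s -> pbound p f c ->
  pbound p (fun x => if x \in s then 0 else f x)
    (c - \sum_(x <- s) `|f x| `^ p).
Proof.
move=> p0 us fc r ur; rewrite lerBrDr.
rewrite (bigID [in s]) /= big1 ?add0r => [|x ->]; last first.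
  by rewrite normr0 powR0 // gt_eqF.
under eq_bigr => x /negbTE -> do [].
rewrite -big_filter -big_cat; apply: fc.
rewrite cat_uniq us andbT filter_uniq //=.
by apply/hasPn => x xs; rewrite mem_filter negb_and negbK xs.
Qed.

Lemma pbound_split p f c (s : seq T) : 0 <= p -> uniq s ->
  pbound p (fun x => if x \in s then 0 else f x) c ->
  pbound p f (\sum_(x <- s) `|f x| `^ p + c).
Proof.
move=> p0 us gc r ur; rewrite (bigID [in s]) /=; apply: lerD.
  rewrite -big_filter; apply: ler_sum_subset; rewrite ?filter_uniq //.
  by move=> x; rewrite mem_filter => /andP[].
apply: le_trans (gc [seq x <- r | x \notin s] (filter_uniq _ ur)).
by rewrite big_filter; apply: ler_sum => x /negbTE ->.
Qed.

(** Dominated convergence. *)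
Lemma psum_dominated (f_ : nat -> T -> R) f p c : 0 < p -> pbound p f c ->
  (forall n x, `|f_ n x| <= `|f x|) ->
  (forall x, f_ n x @[n --> \oo] --> 0) ->
  psum p (f_ n) @[n --> \oo] --> 0.
Proof.
move=> p0 fc dom f0; apply/cvgrPdist_le => e e0.
have e2 : 0 < e / 2 by rewrite divr_gt0.
have [s us sP] := psum_adherent fc e2.
have := pbound_tail p0 us (pbound_psum fc); set g := fun x => _ => gb.
have L : \sum_(x <- s) `|f_ n x| `^ p @[n --> \oo] --> (0 : R).
  have := @cvg_sum_powR \oo eventually_filter p f_ (fun=> 0) s p0 f0.
  by rewrite [X in _ --> X]big1 // => x _; rewrite normr0 powR0 ?gt_eqF.
move/cvgrPdist_le : L => /(_ _ e2); apply: filterS => n.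
rewrite !sub0r !normrN (ger0_norm (psum_ge0 _ _)) => Ln.
apply: psum_le; rewrite [e]splitr.
apply: pbound_le (lerD (le_trans (ler_norm _) Ln) (lexx _)) _.
apply: pbound_split => //; first exact: ltW.
apply: (@pbound_dom _ _ g); first exact: ltW.
  by move=> x; rewrite /g; case: ifP; rewrite // normr0.
by apply: pbound_le gb; rewrite lerBlDr -lerBlDl ltW.
Qed.

Lemma pbound_cvg_psum (F : set_system nat) {FF : ProperFilter F} p
  (f_ : nat -> T -> R) f A : 0 < p ->
  (forall n, pbound p (f_ n) (psum p (f_ n))) ->
  (forall x, f_ n x @[n --> F] --> f x) ->
  psum p (f_ n) @[n --> F] --> A -> pbound p f A.
Proof.
move=> p0 fb fx fA s us.
apply: ler_cvg_to (@cvg_sum_powR F FF p f_ f s p0 fx) fA _.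
by apply: nearW => n; exact: fb.
Qed.

(** Interpolation between [l^p] and [l^oo]. *)
Lemma pbound_interp p r f A B : 0 < p -> p <= r -> pbound p f A ->
  (forall x, `|f x| `^ p <= B) -> pbound r f (B `^ ((r - p) / p) * A).
Proof.
move=> p0 pr fA fB s us.
have B0 : 0 <= B `^ ((r - p) / p) by exact: powR_ge0.
apply: le_trans (ler_wpM2l B0 (fA s us)); rewrite mulr_sumr.
apply: ler_sum => x _.
have [f0|f0] := eqVneq (f x) 0.
  by rewrite f0 normr0 !powR0 ?mulr0 ?gt_eqF // (lt_le_trans p0).
have f1 : 0 < `|f x| by rewrite normr_gt0.
rewrite -{1}[r](subrK p) powRD_gt0 // ler_wpM2r ?powR_ge0 //.
have -> : r - p = p * ((r - p) / p) by rewrite mulrC divfK // gt_eqF.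
rewrite powRrM mulrAC mulfV ?gt_eqF // mul1r.
by apply: ler_powR_base; rewrite ?powR_ge0 // divr_ge0 ?subr_ge0 // ltW.
Qed.

Lemma psumZ (p k c : R) (f : T -> R) : k != 0 ->
  pbound p f c -> psum p (fun x => k * f x) = `|k| `^ p * psum p f.
Proof.
move=> k0 fc; apply/eqP; rewrite eq_le (psumZ_le k fc) /=.
have k1 : 0 < `|k| by rewrite normr_gt0.
rewrite -ler_pdivlMl ?powR_gt0 // -powRN.
have := psumZ_le k^-1 (pboundZ k fc).
rewrite (_ : (fun x => k^-1 * (k * f x)) = f); last first.
  by apply/funext => x; rewrite mulKf.
by rewrite normfV -[_^-1]powR_inv1 // -powRrM mulN1r.
Qed.

Lemma pbound_finite_support p (f : T -> R) : 0 < p ->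
  finite_set [set x | f x != 0] -> exists S, pbound p f S.
Proof.
move=> p0 ff; exists (\sum_(x <- fset_set [set x | f x != 0]) `|f x| `^ p).
move=> s us; rewrite (bigID (fun x => f x == 0)) /= big1 ?add0r; last first.
  by move=> x /eqP ->; rewrite normr0 powR0 // gt_eqF.
rewrite -big_filter; apply: ler_sum_subset; rewrite ?filter_uniq //.
by move=> x; rewrite mem_filter in_fset_set // => /andP[fx _]; exact: mem_set.
Qed.

Lemma finite_superlevel r (f : T -> R) C e : 0 < r -> 0 < e ->
  pbound r f C -> finite_set [set x | e < `|f x|].
Proof.
move=> r0 e0 fC; apply: contrapT => inf.
(* More than [C / e ^ r] points at which [|f| > e] contradict the bound [C]. *)
have er : 0 < e `^ r by rewrite powR_gt0.
have [X XA Xn] := infinite_set_fset (Num.trunc (C / e `^ r)).+1 inf.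
have := fC X (fset_uniq X); apply/negP; rewrite -ltNge.
apply: (@lt_le_trans _ _ (\sum_(x <- X) e `^ r)); last first.
  rewrite big_seq [leRHS]big_seq; apply: ler_sum => x xX.
  by apply: ler_powR_base; rewrite ?ltW //; exact: XA.
rewrite big_const_seq count_predT iter_addr_0 -mulr_natl -ltr_pdivrMr //.
apply: lt_le_trans (_ : (Num.trunc (C / e `^ r)).+1%:R <= _).
  exact: truncnS_gt.
by rewrite ler_nat.
Qed.

(** One inequality of the Brezis-Lieb lemma: adding a fixed summable [c] does not
increase the mass lost in a pointwise limit. Off a large finite set [c] is negligible,
so there [a_ n] costs at most [(1 - t) ^ (1 - p)] times [b_ n] plus an error,
while on the finite set both converge. *)
Lemma mass_loss_le (F : set_system nat) {FF : ProperFilter F} p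
  (a_ b_ : nat -> T -> R) (a b c : T -> R) A B K : 1 <= p ->
  (forall n, pbound p (a_ n) (psum p (a_ n))) ->
  (forall n, pbound p (b_ n) (psum p (b_ n))) ->
  pbound p c K ->
  (forall n x, a_ n x = b_ n x + c x) ->
  (forall x, a_ n x @[n --> F] --> a x) ->
  (forall x, b_ n x @[n --> F] --> b x) ->
  psum p (a_ n) @[n --> F] --> A -> psum p (b_ n) @[n --> F] --> B ->
  A - psum p a <= B - psum p b.
Proof.
move=> p1 an bn cK abc ax bx aA bB.
have p0 : 0 < p by apply: lt_le_trans p1.
have bB' : pbound p b B by exact: (pbound_cvg_psum p0 bn bx bB).
have aA' : pbound p a A by exact: (pbound_cvg_psum p0 an ax aA).
have main t d : 0 < t < 1 -> 0 < d -> A - psum p a <=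
    (1 - t) `^ (1 - p) * (B - psum p b + d) + t `^ (1 - p) * d.
  move=> /andP[t0 t1] d0; have t1' : 0 < 1 - t by rewrite subr_gt0.
  have [s1 us1 s1P] := psum_adherent bB' d0.
  have [s2 us2 s2P] := psum_adherent cK d0.
  pose s := undup (s1 ++ s2).
  have us : uniq s by exact: undup_uniq.
  have s1s : {subset s1 <= s} by move=> x xs; rewrite mem_undup mem_cat xs.
  have s2s : {subset s2 <= s}.
    by move=> x xs; rewrite mem_undup mem_cat xs orbT.
  have pge (f : T -> R) x : 0 <= `|f x| `^ p by exact: powR_ge0.
  have {}s1P := lt_le_trans s1P (ler_sum_subset (pge _) us1 us s1s).
  have {}s2P := lt_le_trans s2P (ler_sum_subset (pge _) us2 us s2s).
  have step n : psum p (a_ n) - \sum_(x <- s) `|a_ n x| `^ p <=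
      (1 - t) `^ (1 - p) * (psum p (b_ n) - \sum_(x <- s) `|b_ n x| `^ p)
      + t `^ (1 - p) * d.
    rewrite lerBlDl; apply: psum_le; apply: pbound_split => //; first exact: ltW.
    have := pboundD p1 t1' t0 (pbound_tail p0 us (bn n))
      (pbound_tail p0 us (pbound_psum cK)).
    rewrite subrK powR1 mul1r => H.
    apply: pbound_le (pbound_ext _ H).
      rewrite lerD2l ler_wpM2l ?powR_ge0 // lerBlDr -lerBlDl; exact: ltW.
    by move=> x /=; case: ifP => _; rewrite ?addr0 // abc.
  have lim : A - \sum_(x <- s) `|a x| `^ p <=
      (1 - t) `^ (1 - p) * (B - \sum_(x <- s) `|b x| `^ p) + t `^ (1 - p) * d.
    have La : psum p (a_ n) - \sum_(x <- s) `|a_ n x| `^ p @[n --> F] -->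
        A - \sum_(x <- s) `|a x| `^ p.
      by apply: cvgB => //; exact: cvg_sum_powR.
    have Lb : (1 - t) `^ (1 - p) * (psum p (b_ n) - \sum_(x <- s) `|b_ n x| `^ p)
      + t `^ (1 - p) * d @[n --> F] --> (1 - t) `^ (1 - p) *
      (B - \sum_(x <- s) `|b x| `^ p) + t `^ (1 - p) * d.
      apply: cvgD; last exact: cvg_cst.
      apply: cvgM; first exact: cvg_cst.
      by apply: cvgB => //; exact: cvg_sum_powR.
    by apply: ler_cvg_to La Lb _; apply: nearW.
  apply: le_trans (le_trans lim _).
    by rewrite lerB // (pbound_psum aA' us).
  rewrite lerD2r ler_wpM2l ?powR_ge0 //; rewrite -addrA lerD2l.
  by rewrite lerNl opprD opprK ltW.
have Y0 : 0 <= B - psum p b by rewrite subr_ge0; exact: psum_le.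
have main2 t : 0 < t < 1 -> A - psum p a <= (1 - t) `^ (1 - p) * (B - psum p b).
  move=> t01; apply/ler_addgt0Pr => e e0.
  have k0 : 0 < (1 - t) `^ (1 - p) + t `^ (1 - p).
    by case/andP: t01 => t0 _; rewrite ltr_wpDl ?powR_ge0 ?powR_gt0.
  apply: le_trans (main _ _ t01 (divr_gt0 e0 k0)) _.
  by rewrite mulrDr -addrA -mulrDl mulrCA divff ?gt_eqF // mulr1.
have C : (1 - t) `^ (1 - p) * (B - psum p b) @[t --> 0^'+] -->
    1 * (B - psum p b).
  apply: cvgM; last exact: cvg_cst.
  have L : 1 - t @[t --> 0^'+] --> (1 : R).
    rewrite -[X in _ --> X]subr0; apply: cvgB; first exact: cvg_cst.
    exact: cvg_at_right_filter.
  have := cvg_comp _ _ L (@continuous_powR_gt0 R (1 - p) 1 ltr01).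
  by rewrite powR1.
rewrite -[leRHS]mul1r; apply: (cvgr_to_ge C).
by near=> t; apply: main2; apply/andP; split.
Unshelve. all: by end_near. Qed.

End PowerSums.

Lemma pbound_inj {R : realType} {T T' : choiceType} (h : T' -> T) p
    (f : T -> R) c :
  injective h -> pbound p f c -> pbound p (f \o h) c.
Proof.
move=> hi H s us; rewrite -(big_map h xpredT (fun x => `|f x| `^ p)).
by apply: H; rewrite map_inj_uniq.
Qed.

Lemma psum_bij {R : realType} {T T' : choiceType} (p c : R) (f : T -> R)
    (h : T' -> T) h' :
  cancel h h' -> cancel h' h -> pbound p f c -> psum p (f \o h) = psum p f.
Proof.
move=> hK h'K fc; have fc' := pbound_psum fc.
apply/eqP; rewrite eq_le; apply/andP; split; apply: psum_le.
  exact: (pbound_inj (can_inj hK) fc').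
apply: (@pbound_ext _ _ _ ((f \o h) \o h')) => [x /=|]; first by rewrite h'K.
by apply: pbound_inj (can_inj h'K) (pbound_psum (pbound_inj (can_inj hK) fc)).
Qed.

(** * Geometric series of power sums *)

Section SeriesBounds.
Context {R : realType} {T : choiceType}.
Implicit Types (p r : R) (f : T -> R).

(** Summation of a geometrically decaying series in [l^r], by Jensen's inequality
with the weights [t ^ k]. *)
Lemma pbound_series (D : nat -> T -> R) r t C n : 1 <= r -> 0 < t < 1 ->
  0 <= C -> (forall k, pbound r (D k) (C * (t ^+ k) `^ r)) ->
  pbound r (fun x => \sum_(k < n) D k x) (C * (1 - t)^-1 `^ r).
Proof.
move=> r1 /andP[t0 t1] C0 DC s us.
have r0 : 0 < r by apply: lt_le_trans r1.
have tk (k : 'I_n) : 0 < t ^+ k by rewrite exprn_gt0.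
pose W := \sum_(k < n) t ^+ k.
have W0 : 0 <= W by apply: sumr_ge0 => k _; exact: ltW.
have WC : C * W `^ r <= C * (1 - t)^-1 `^ r.
  rewrite ler_wpM2l // ler_powR_base //; first exact: ltW.
  by apply: sum_geometric_le; rewrite (ltW t0) t1.
apply: le_trans WC.
apply: (@le_trans _ _ (\sum_(x <- s) W `^ (r - 1) *
    \sum_(k < n) (t ^+ k) `^ (1 - r) * `|D k x| `^ r)).
  by apply: ler_sum => x _; apply: powR_norm_sum.
rewrite -mulr_sumr exchange_big /=.
apply: (@le_trans _ _ (W `^ (r - 1) * \sum_(k < n) C * t ^+ k)).
  rewrite ler_wpM2l ?powR_ge0 //; apply: ler_sum => k _.
  rewrite -mulr_sumr.
  apply: le_trans (ler_wpM2l (powR_ge0 _ _) (DC k s us)) _.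
  by rewrite mulrCA -powRD_gt0 // subrK powRr1 // ltW.
rewrite -mulr_sumr mulrCA ler_wpM2l // -/W mulrC.
have [->|Wn0] := eqVneq W 0; first by rewrite mul0r powR_ge0.
have W1 : 0 < W by rewrite lt_neqAle eq_sym Wn0.
by rewrite -{1}[W]powRr1 // -powRD_gt0 // addrC subrK.
Qed.

End SeriesBounds.

(** * The gradient and averages over cubes *)

Section Sobolev.
Context {R : realType} {N : nat}.
Implicit Types (p r M : R) (u : lattice N -> R) (x y : lattice N).

(** Oriented edges are pairs of neighbours and the gradient vanishes on the other
pairs, so that the energy is a power sum over a single index type. *)
Definition grad u (e : lattice N * lattice N) : R :=
  if adj e.1 e.2 then u e.2 - u e.1 else 0.

Definition cube_pt h (z : 'rV['I_h]_N) : lattice N :=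
  map_mx (fun i : 'I_h => (i : nat)%:Z) z.

Definition cube_avg h u x : R :=
  #|{: 'rV['I_h]_N}|%:R^-1 * \sum_(z : 'rV['I_h]_N) u (x + cube_pt z).

Lemma card_cube h : #|{: 'rV['I_h]_N}| = (h ^ N)%N.
Proof. by rewrite card_mx card_ord mul1n. Qed.

Lemma card_cube_neq0 h : (0 < h)%N -> #|{: 'rV['I_h]_N}|%:R != 0 :> R.
Proof. by move=> h0; rewrite card_cube pnatr_eq0 -lt0n expn_gt0 h0. Qed.

Lemma cube_pt_inj h : injective (@cube_pt h).
Proof.
move=> z z' /matrixP E; apply/matrixP => i j; have := E i j.
by rewrite !mxE => -[] /val_inj.
Qed.

Lemma cube_pt_surj h (v : lattice N) : (forall i, 0 <= v ord0 i < h%:Z) ->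
  exists z : 'rV['I_h]_N, v = cube_pt z.
Proof.
move=> H; have pos i : (absz (v ord0 i) < h)%N.
  by have /andP[v0 vh] := H i; rewrite -ltz_nat gez0_abs.
exists (\row_i Ordinal (pos i)); apply/matrixP => i j.
by rewrite (ord1 i) !mxE /= gez0_abs //; case/andP: (H j).
Qed.

Lemma adj_shift z x y : adj (x + z) (y + z) = adj x y.
Proof.
rewrite /adj; congr (_ == _); apply: eq_bigr => i _.
by rewrite !mxE opprD addrACA subrr addr0.
Qed.

Lemma pbound_shift p u M z : pbound p u M -> pbound p (fun x => u (x + z)) M.
Proof. by apply: (@pbound_inj _ _ _ (fun x => x + z)); exact: addIr. Qed.

Lemma pbound_grad_shift p u M z : pbound p (grad u) M ->
  pbound p (grad (fun x => u (x + z))) M.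
Proof.
have I : injective (fun e : lattice N * lattice N => (e.1 + z, e.2 + z)).
  by move=> [a b] [c d] [/addIr -> /addIr ->].
move=> /(pbound_inj I); apply: pbound_ext => e.
by rewrite /grad /= adj_shift.
Qed.

Lemma gradB u v e : grad (fun x => u x - v x) e = grad u e - grad v e.
Proof. by rewrite /grad; case: ifP => _; rewrite ?subr0 //; ring. Qed.

Lemma cube_avg_grad h u e : grad (cube_avg h u) e =
  #|{: 'rV['I_h]_N}|%:R^-1 *
    \sum_(z : 'rV['I_h]_N) grad (fun x => u (x + cube_pt z)) e.
Proof.
rewrite /grad /cube_avg; case: ifP => _; last by rewrite big1 ?mulr0.
by rewrite -mulrBr sumrB.
Qed.

Lemma pbound_grad_avg p u M h : 1 <= p -> pbound p (grad u) M ->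
  pbound p (grad (cube_avg h u)) M.
Proof.
move=> p1 uM.
apply: (pbound_ext (fun e => esym (cube_avg_grad h u e))).
apply: pbound_avg => // [|z]; first exact: pbound_ge0 uM.
exact: pbound_grad_shift.
Qed.

Lemma pbound_cube_avg p u M h : 1 <= p -> pbound p u M ->
  pbound p (cube_avg h u) M.
Proof.
move=> p1 uM; apply: pbound_avg => // [|z]; first exact: pbound_ge0 uM.
exact: pbound_shift.
Qed.

(** An average over [h ^ N] distinct points sees each value of [u] at most once
with weight [h ^ - N]. *)
Lemma cube_avg_sup p u M h x : 1 <= p -> pbound p u M ->
  `|cube_avg h u x| `^ p <= (h ^ N)%:R^-1 * M.
Proof.
move=> p1 uM.
apply: le_trans (powR_norm_avg (fun z => u (x + cube_pt z)) p1) _.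
rewrite card_cube ler_wpM2l ?invr_ge0 ?ler0n //.
have I : injective (fun z : 'rV['I_h]_N => x + cube_pt z).
  by move=> z z' /addrI /cube_pt_inj.
exact: (pbound_inj I uM (index_enum_uniq _)).
Qed.

Lemma cube_avgC h k u x : cube_avg h (cube_avg k u) x =
  cube_avg k (cube_avg h u) x.
Proof.
rewrite /cube_avg -!mulr_sumr mulrCA exchange_big /=; congr (_ * (_ * _)).
by apply: eq_bigr => z _; apply: eq_bigr => z' _; rewrite addrAC.
Qed.

Lemma cube_avgB h u v x : cube_avg h (fun y => u y - v y) x =
  cube_avg h u x - cube_avg h v x.
Proof. by rewrite /cube_avg sumrB mulrBr. Qed.

(** * Poincare's inequality on cubes *)

Section Translates.
Variables (p M : R) (u : lattice N -> R).
Hypotheses (p1 : 1 <= p) (uM : pbound p (grad u) M).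

Let M0 : 0 <= M. Proof. exact: pbound_ge0 uM. Qed.
Let p0 : 0 < p. Proof. exact: lt_le_trans p1. Qed.

(** The translation by [y] moves [u] in [l^p] by no more than a lattice path of
length [c] would. *)
Definition displaced y c := pbound p (fun x => u (x + y) - u x) (c `^ p * M).

Lemma displaced_le y c d : 0 <= c -> c <= d -> displaced y c -> displaced y d.
Proof.
move=> c0 cd; apply: pbound_le; rewrite ler_wpM2r //.
by apply: ler_powR_base => //; exact: ltW.
Qed.

Lemma displaced0 c : displaced 0 c.
Proof.
move=> s us; rewrite big1 ?mulr_ge0 ?powR_ge0 // => x _.
by rewrite addr0 subrr normr0 powR0 // gt_eqF.
Qed.

Lemma displacedD y z c d : 0 < c -> 0 < d ->
  displaced y c -> displaced z d -> displaced (y + z) (c + d).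
Proof.
move=> c0 d0 yc zd; have := pboundD p1 c0 d0 (pbound_shift z yc) zd.
rewrite !mulrA -!powRD_gt0 // !subrK !powRr1; [|exact: ltW..].
rewrite -mulrDl mulrA -{2}[c + d]powRr1; last by rewrite ltW // addr_gt0.
rewrite -powRD_gt0 ?addr_gt0 // subrK; apply: pbound_ext => x.
by rewrite addrA subrK -addrA [z + y]addrC.
Qed.

Lemma displaced_unit i : displaced (delta_mx 0 i) 1.
Proof.
rewrite /displaced powR1 mul1r.
have I : injective (fun x : lattice N => (x, x + delta_mx 0 i)).
  by move=> x y [].
apply: pbound_ext (pbound_inj I uM) => x; rewrite /grad /= /adj.
rewrite (bigD1 i) //= big1 => [|j ji]; rewrite !mxE !eqxx /=.
  by rewrite addr0 opprD addrA subrr sub0r normrN normr1.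
by rewrite (negbTE ji) addr0 subrr normr0.
Qed.

Lemma displaced_axis i j : (0 < j)%N -> displaced (delta_mx 0 i *+ j) j%:R.
Proof.
elim: j => // -[|j] IH _; first exact: displaced_unit.
rewrite mulrS -[j.+2]add1n natrD; apply: displacedD => //.
  exact: displaced_unit.
exact: IH.
Qed.

Lemma displaced_cube h (z : 'rV['I_h]_N) : (0 < h)%N ->
  displaced (cube_pt z) (h * N.+1)%:R.
Proof.
move=> h0; have h0' : 0 < h%:R :> R by rewrite ltr0n.
have -> : cube_pt z = \sum_i delta_mx 0 i *+ (z 0 i : nat).
  rewrite [LHS]row_sum_delta; apply: eq_bigr => i _.
  by rewrite mxE -scaler_nat natz.
(* The empty sum gets the displacement [h] instead of 0, because [displacedD] needs
   positive weights; this is the extra 1 in [N.+1]. *)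
suff H (s : seq 'I_N) :
    displaced (\sum_(i <- s) delta_mx 0 i *+ (z 0 i : nat)) (h * (size s).+1)%:R.
  have := H (index_enum 'I_N); rewrite [size _](_ : _ = N) //.
  by rewrite -[RHS]card_ord cardT enumT.
elim: s => [|i s IH]; first by rewrite big_nil; exact: displaced0.
rewrite big_cons /= mulnS natrD; apply: displacedD => //.
  by rewrite ltr0n muln_gt0 h0.
have [->|zi0] := posnP (z 0 i); first by rewrite mulr0n; exact: displaced0.
by apply: displaced_le (displaced_axis i zi0); rewrite ?ler0n // ler_nat ltnW.
Qed.

(** [u - cube_avg h u] is an average of differences of [u] with its translates. *)
Lemma cube_poincare h : (0 < h)%N ->
  pbound p (fun x => u x - cube_avg h u x) ((h * N.+1)%:R `^ p * M).
Proof.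
move=> h0.
have E x : #|{: 'rV['I_h]_N}|%:R^-1 *
    \sum_(z : 'rV['I_h]_N) - (u (x + cube_pt z) - u x) = u x - cube_avg h u x.
  rewrite sumrN sumrB sumr_const mulrN mulrBr -[_ *+ #|_|]mulr_natl.
  by rewrite mulKf ?card_cube_neq0 // opprB.
apply: (pbound_ext E); apply: pbound_avg => // [|z].
  by rewrite mulr_ge0 ?powR_ge0.
by apply: pboundN; exact: displaced_cube.
Qed.

End Translates.

(** * The Sobolev inequality above the critical exponent *)

Section Telescope.
Variables (p M : R) (u : lattice N -> R).
Hypotheses (p1 : 1 <= p) (uM : pbound p (grad u) M).

Let M0 : 0 <= M. Proof. exact: pbound_ge0 uM. Qed.
Let p0 : 0 < p. Proof. exact: lt_le_trans p1. Qed.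

Fixpoint dyadic_avg k : lattice N -> R :=
  if k is k'.+1 then cube_avg (2 ^ k) (dyadic_avg k') else u.

Definition dyadic_diff k x := dyadic_avg k x - dyadic_avg k.+1 x.

Lemma pbound_grad_dyadic k : pbound p (grad (dyadic_avg k)) M.
Proof. by elim: k => //= k IH; exact: pbound_grad_avg. Qed.

Let K := (2 * N.+1)%:R `^ p * M.

Let scaleE k : (2 ^ k.+1 * N.+1)%:R `^ p * M = K * (2 `^ p) ^+ k :> R.
Proof.
rewrite /K expnS mulnAC natrM powRM ?ler0n // mulrAC natrX powR_exprn //.
Qed.

Lemma pbound_dyadic_diff k : pbound p (dyadic_diff k) (K * (2 `^ p) ^+ k).
Proof.
rewrite -scaleE; apply: cube_poincare => //; first exact: pbound_grad_dyadic.
by rewrite expn_gt0.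
Qed.

(** The differences gain decay in the supremum norm from the average that built
[dyadic_avg k]: averages over different cubes commute. *)
Lemma dyadic_diff_sup k x :
  `|dyadic_diff k x| `^ p <= K * (2 `^ (p - N%:R)) ^+ k.
Proof.
have -> : K * (2 `^ (p - N%:R)) ^+ k =
    ((2 ^ k) ^ N)%:R^-1 * (K * (2 `^ p) ^+ k).
  rewrite mulrCA; congr (_ * _).
  rewrite powRD_gt0 // exprMn mulrC powRN exprVn; congr (_^-1 * _).
  by rewrite powR_mulrn // -exprM -expnM natrX mulnC.
case: k => [|k].
  by rewrite expn0 exp1n invr1 mul1r; apply/pbound_pt/pbound_dyadic_diff.
have E : dyadic_diff k.+1 x = cube_avg (2 ^ k.+1)
    (fun y => dyadic_avg k y - cube_avg (2 ^ k.+2) (dyadic_avg k) y) x.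
  by rewrite /dyadic_diff cube_avgB cube_avgC.
rewrite E; apply: cube_avg_sup => //.
rewrite -scaleE; apply: cube_poincare => //; first exact: pbound_grad_dyadic.
by rewrite expn_gt0.
Qed.

Lemma sum_dyadic_diff n x :
  \sum_(k < n) dyadic_diff k x = u x - dyadic_avg n x.
Proof.
elim: n => [|n IH]; first by rewrite big_ord0 subrr.
by rewrite big_ord_recr IH /= /dyadic_diff addrA subrK.
Qed.

Lemma dyadic_avg_cvg0 S x : (0 < N)%N -> pbound p u S ->
  dyadic_avg n x @[n --> \oo] --> 0.
Proof.
move=> N0 uS.
have b n : pbound p (dyadic_avg n) S.
  by elim: n => //= n IH; exact: pbound_cube_avg.
have S0 := pbound_ge0 uS.
have H n : `|dyadic_avg n.+1 x| `^ p <= S * 2^-1 ^+ n.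
  apply: le_trans (cube_avg_sup _ x p1 (b n)) _.
  rewrite mulrC ler_wpM2l // exprVn -natrX lef_pV2 ?posrE ?ltr0n ?expn_gt0 //.
  by rewrite ler_nat -expnM leq_exp2l // (leq_trans (leqnSn n)) // leq_pmulr.
rewrite -cvg_shiftS; apply: (cvg0_norm_powR_le p0 H).
rewrite -[X in _ --> X](mulr0 S); apply: cvgM; first exact: cvg_cst.
by apply: cvg_expr; rewrite ger0_norm ?invf_lt1 ?ltr1n.
Qed.

End Telescope.

(** Interpolating [pbound_dyadic_diff] with [dyadic_diff_sup] bounds the [k]-th
difference in [l^r] by a multiple of [2 ^ (- b k / r)]; the exponent [b] is
positive exactly when [r] exceeds the Sobolev exponent [N p / (N - p)]. *)
Lemma sobolev_supercritical p r M : 1 < p -> p < N%:R ->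
  N%:R * p / (N%:R - p) < r -> 0 <= M ->
  exists C : R, forall u S, pbound p u S -> pbound p (grad u) M -> pbound r u C.
Proof.
move=> p1 pN rp M0.
have p0 : 0 < p by apply: lt_trans p1.
have Np : 0 < N%:R - p by rewrite subr_gt0.
have N0 : (0 < N)%N by rewrite -(ltr0n R); exact: lt_trans pN.
have rp' : N%:R * p < r * (N%:R - p) by rewrite -ltr_pdivrMr.
have pr : p < r by nra.
have r0 : 0 < r by apply: lt_trans pr.
pose K := (2 * N.+1)%:R `^ p * M.
pose b := (N%:R - p) * ((r - p) / p) - p.
have b0 : 0 < b.
  rewrite (_ : b = (r * (N%:R - p) - N%:R * p) / p).
    by rewrite divr_gt0 // subr_gt0.
  by rewrite /b; field; rewrite gt_eqF.
pose t : R := 2 `^ (- b / r).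
have t01 : 0 < t < 1.
  rewrite powR_gt0 //= /t mulNr powRN invf_lt1 ?powR_gt0 //.
  by apply: powR_gt1; rewrite ?ltr1n ?divr_gt0.
exists (K `^ ((r - p) / p) * K * (1 - t)^-1 `^ r) => u S uS uM.
have K0 : 0 <= K by rewrite mulr_ge0 ?powR_ge0.
have D k : pbound r (dyadic_diff u k) (K `^ ((r - p) / p) * K * (t ^+ k) `^ r).
  have := pbound_interp p0 (ltW pr) (pbound_dyadic_diff (ltW p1) uM k)
    (dyadic_diff_sup (ltW p1) uM k).
  apply: pbound_le; rewrite -/K powRM ?exprn_ge0 ?powR_ge0 // mulrACA.
  rewrite ![(_ ^+ k) `^ _]powR_exprn ?powR_ge0 // -exprMn.
  rewrite -!powRrM -powRD_gt0 // (_ : - b / r * r = - b).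
    by rewrite (_ : (p - N%:R) * _ + p = - b) // /b; ring.
  by rewrite divfK // gt_eqF.
have H n := pbound_series n (ltW (lt_trans p1 pr)) t01
  (mulr_ge0 (powR_ge0 _ _) K0) D.
apply: (@pbound_cvg _ _ \oo _ r
  (fun n x => \sum_(k < n) dyadic_diff u k x)) => //.
  exact: nearW.
move=> x; have L : u x - dyadic_avg u n x @[n --> \oo] --> u x.
  rewrite -[X in _ --> X]subr0; apply: cvgB; first exact: cvg_cst.
  exact: (dyadic_avg_cvg0 (ltW p1) x N0 uS).
by under eq_cvg do rewrite sum_dyadic_diff.
Qed.

End Sobolev.

(** * The space D_0^{1,p} *)

Section NormsAsPowerSums.
Context {R : realType} {N : nat}.
Implicit Types (p b q : R) (u : lattice N -> R).

Lemma esum_powE p u : 0 < p ->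
  (\esum_(x in [set: lattice N]) \esum_(y in [set y | adj x y])
      (`|u y - u x| `^ p)%:E)%E = esum_pow p (grad u).
Proof.
move=> p0.
transitivity (\esum_(x in [set: lattice N]) \esum_(y in [set: lattice N])
    (`|grad u (x, y)| `^ p)%:E)%E.
  apply: eq_esum => x _; rewrite esum_mkcond; apply: eq_esum => y _.
  rewrite /grad /=; case: ifPn => [/set_mem /= -> //|].
  rewrite notin_setE /= => /negP/negbTE ->.
  by rewrite normr0 powR0 // gt_eqF.
rewrite esum_esum => [|x y _ _]; last by rewrite lee_fin powR_ge0.
rewrite (_ : [set: lattice N] `*`` (fun=> [set: lattice N]) = setT).
  by apply: eq_esum => -[x y].
by apply/seteqP; split.
Qed.

Lemma norm_D1pE p u : 0 < p ->
  norm_D1p p u = ((esum_pow p (grad u)) `^ p^-1)%E.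
Proof. by move=> p0; rewrite /norm_D1p esum_powE. Qed.

Lemma poweR_cancel p (x : \bar R) : p != 0 -> (0 <= x)%E ->
  ((x `^ p^-1) `^ p)%E = x.
Proof. by move=> p0 x0; rewrite -poweRrM mulVf // poweRe1. Qed.

Lemma norm_D1p_pow p u : 0 < p ->
  (norm_D1p p u `^ p)%E = esum_pow p (grad u).
Proof.
by move=> p0; rewrite norm_D1pE // poweR_cancel ?gt_eqF // esum_pow_ge0.
Qed.

Definition weighted b u (x : lattice N) : R := weight b x * u x.

Lemma norm_lbqE b q u :
  norm_lbq b q u = ((esum_pow q (weighted b u)) `^ q^-1)%E.
Proof.
rewrite /norm_lbq; congr poweR; apply: eq_esum => x _; congr EFin.
rewrite /weighted normrM powRM // ger0_norm ?powR_ge0 //.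
by rewrite /weight powRrM.
Qed.

Lemma norm_lbq_eq1 b q u : 0 < q ->
  norm_lbq b q u = 1%E <->
  pbound q (weighted b u) (psum q (weighted b u)) /\
  psum q (weighted b u) = 1.
Proof.
move=> q0; rewrite norm_lbqE.
have E0 := esum_pow_ge0 q (weighted b u).
split=> [H|[H1 H2]]; last by rewrite (esum_pow_psum H1) H2 poweR1r.
have H1 : esum_pow q (weighted b u) = 1%E.
  by rewrite -[LHS](@poweR_cancel q) ?gt_eqF // H poweR1r.
split; first by apply: esum_pow_lty; rewrite H1 ltry.
by rewrite /psum H1.
Qed.

End NormsAsPowerSums.

Section CompletionSpace.
Context {R : realType} {N : nat}.
Implicit Types (p r : R) (u : lattice N -> R).

Lemma adj_sym (x y : lattice N) : adj x y = adj y x.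
Proof.
by rewrite /adj; congr (_ == _); apply: eq_bigr => i _; rewrite distrC.
Qed.

Lemma adj_coord_le (x y : lattice N) i :
  adj x y -> `|x ord0 i - y ord0 i| <= 1.
Proof.
by move=> /eqP <-; rewrite (bigD1 i) //= lerDl sumr_ge0.
Qed.

Lemma finite_neighbourhood (A : set (lattice N)) : finite_set A ->
  finite_set [set y | exists2 x, A x & x = y \/ adj x y].
Proof.
move=> finA; pose v (z : 'rV['I_3]_N) : lattice N := cube_pt z - const_mx 1.
apply: sub_finite_set (finite_image2 (fun x z => x + v z) finA
  (@finite_finset _ setT)).
move=> y [x Ax xy]; exists x => //.
have [i|z zE] := cube_pt_surj (h := 3) (v := y - x + const_mx 1).
  have : `|y ord0 i - x ord0 i| <= 1.
    case: xy => [->|]; first by rewrite subrr normr0.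
    by rewrite adj_sym => /adj_coord_le.
  by rewrite !mxE ler_norml; move: (y ord0 i) (x ord0 i) => k l; lia.
by exists z => //; rewrite /v -zE addrK addrC subrK.
Qed.

Lemma finitely_supported_pbound p u : 0 < p -> finitely_supported u ->
  (exists S, pbound p u S) /\ (exists S, pbound p (grad u) S).
Proof.
move=> p0 fu; split; first exact: pbound_finite_support.
apply: pbound_finite_support => //.
have fB := finite_neighbourhood fu.
apply: sub_finite_set (finite_setX fB fB) => -[x y] /=.
rewrite /grad /=; case: ifPn => [xy|]; last by rewrite eqxx.
have [ux|ux] := eqVneq (u x) 0; last first.
  by move=> _; split; exists x => //=; [left|right].
rewrite ux subr0 => uy; split; exists y => //=; last by left.
by right; rewrite adj_sym.
Qed.

Lemma D0_approx p u : 0 < p -> D0_1p p u ->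
  exists phi : nat -> lattice N -> R,
    [/\ forall n, finitely_supported (phi n),
        forall x, phi n x @[n --> \oo] --> u x &
        \forall n \near \oo, pbound p (grad (fun x => phi n x - u x)) 1].
Proof.
move=> p0 [phi [fphi /fine_cvgP[fin lim] cphi]]; exists phi; split => //.
have lt1 : \forall n \near \oo, fine (norm_D1p p (phi n \- u)) < 1.
  by apply: (cvgr_lt _ lim); exact: ltr01.
apply: filterS (filterI fin lt1) => n [{}fin {}lt1].
apply/pboundE; rewrite -norm_D1p_pow // -(fineK fin) poweR_EFin lee_fin.
have <- : 1 `^ p = 1 :> R by rewrite powR1.
apply: ler_powR_base; [exact: ltW|exact/fine_ge0/poweR_ge0|].
exact: ltW.
Qed.

Lemma D0_grad p u : 1 <= p -> D0_1p p u -> exists M, pbound p (grad u) M.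
Proof.
move=> p1; have p0 : 0 < p by apply: lt_le_trans p1.
move=> /(D0_approx p0)[phi [fphi _ /filter_ex[n H]]].
have [_ [S phiS]] := finitely_supported_pbound p0 (fphi n).
exists (2 `^ (p - 1) * (S + 1)); apply: pbound_ext (pboundB_half p1 phiS H).
by move=> e /=; rewrite gradB opprB addrC subrK.
Qed.

(** The Sobolev inequality passes to the completion: the approximants eventually
have energy at most [2 ^ (p - 1) (1 + M)], and Fatou's lemma applies. *)
Lemma D0_sobolev p r M : 1 < p -> p < N%:R -> N%:R * p / (N%:R - p) < r ->
  0 <= M -> exists C : R,
  forall u, D0_1p p u -> pbound p (grad u) M -> pbound r u C.
Proof.
move=> p1 pN rp M0; have p0 : 0 < p by apply: lt_trans p1.
have r0 : 0 < r.
  apply: lt_trans rp; rewrite divr_gt0 ?subr_gt0 // mulr_gt0 //.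
  exact: lt_trans pN.
have M1 : 0 <= 2 `^ (p - 1) * (1 + M) by rewrite mulr_ge0 ?powR_ge0 ?addr_ge0.
have [C HC] := sobolev_supercritical p1 pN rp M1.
exists C => u /(D0_approx p0)[phi [fphi cphi H]] uM.
apply: (@pbound_cvg _ _ \oo _ r phi) => //.
apply: filterS H => n H.
have [[S phiS] _] := finitely_supported_pbound p0 (fphi n).
apply: HC phiS _; apply: pbound_ext (pboundD_half (ltW p1) H uM) => e /=.
by rewrite gradB subrK.
Qed.

Definition clamp (e t : R) : R := Num.max (- e) (Num.min e t).

Lemma clamp_norm e t : 0 <= e -> `|clamp e t| <= e.
Proof.
by move=> e0; rewrite ler_norml /clamp !(le_max, ge_max, ge_min) !lexx /=; lra.
Qed.

Lemma clamp_id e t : `|t| <= e -> clamp e t = t.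
Proof.
by rewrite ler_norml /clamp => /andP[et te]; rewrite (min_idPr te) (max_idPr et).
Qed.

Lemma clamp_dist e s t : 0 <= e -> `|clamp e s - clamp e t| <= `|s - t|.
Proof.
move=> e0.
suff H a b : clamp e a - clamp e b <= `|a - b|.
  by rewrite ler_norml H andbT lerNl opprB distrC H.
have := ler_norm (a - b); have := normr_ge0 (a - b).
rewrite /clamp !maxElt !minElt.
by case: (ltrP e a) => ?; case: (ltrP e b) => ?;
  do 2?[case: ltrP => ?] => *; lra.
Qed.

(** Removing from [u] its truncation at height [1 / (n + 1)] leaves a finitely
supported function, and the energy of the truncation tends to 0 by dominated
convergence. *)
Lemma D0_intro p r u M C : 0 < p -> 0 < r ->
  pbound p (grad u) M -> pbound r u C -> D0_1p p u.
Proof.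
move=> p0 r0 uM uC.
pose c n x := clamp n.+1%:R^-1 (u x).
have e0 n : 0 < n.+1%:R^-1 :> R by rewrite invr_gt0.
have dom n e : `|grad (c n) e| <= `|grad u e|.
  rewrite /grad; case: ifP => _; last by rewrite normr0.
  by apply: clamp_dist; exact: ltW.
have c0 x : c n x @[n --> \oo] --> 0.
  apply: (cvg0_norm_powR_le ltr01 _ (@cvg_harmonic R)) => n.
  by rewrite powRr1 //; apply: clamp_norm; exact: ltW.
exists (fun n x => u x - c n x); split=> [n||x].
    apply: sub_finite_set (finite_superlevel r0 (e0 n) uC) => x /= H.
    by rewrite ltNge; apply: contra H => H; rewrite /c clamp_id ?subrr.
  have E n : norm_D1p p ((fun x => u x - c n x) \- u) =
      ((psum p (grad (c n))) `^ p^-1)%:E.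
    rewrite norm_D1pE // -poweR_EFin; congr poweR.
    rewrite -(esum_pow_psum (pbound_dom (ltW p0) (dom n) uM)).
    apply: eq_esum => e _; congr EFin; congr powR.
    rewrite -[RHS]normrN; congr `|_|.
    by rewrite /grad; case: ifP => _; rewrite ?oppr0 //=; ring.
  under eq_cvg do rewrite E.
  apply: cvg_EFin; first exact: nearW.
  have L : psum p (grad (c n)) @[n --> \oo] --> 0.
    apply: psum_dominated uM dom _ => // e.
    rewrite /grad; case: (adj e.1 e.2); last exact: cvg_cst.
    by rewrite -[X in _ --> X](subr0 0); exact: cvgB.
  have := @cvg_norm_powR R \oo eventually_filter _ _ p^-1 _ L.
  rewrite normr0 powR0 ?invr_eq0 ?gt_eqF // => /(_ _)/(_ _).
  rewrite invr_gt0 => /(_ p0).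
  move=> H; apply: cvg_trans H; apply: near_eq_cvg; apply: nearW => n /=.
  by rewrite ger0_norm ?psum_ge0.
by rewrite -[X in _ --> X]subr0; apply: cvgB => //; exact: cvg_cst.
Qed.

End CompletionSpace.

(** * Lattice sums of powers of the distance *)

Section LatticeSums.
Context {R : realType} {N : nat}.
Implicit Types (x y : lattice N) (b t r : R).

Lemma walk_coord_le x (s : seq (lattice N)) i : path (@adj N) x s ->
  `|last x s ord0 i - x ord0 i| <= (size s)%:R.
Proof.
elim: s x => [|y s IH] x /=; first by rewrite subrr normr0.
move=> /andP[xy ys]; apply: le_trans (ler_distD (y ord0 i) _ _) _.
by rewrite -[leRHS]natr1 lerD ?IH // distrC adj_coord_le.
Qed.

Lemma dist0_coord_le x i : `|x ord0 i| <= (dist0 x)%:R.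
Proof.
rewrite /dist0; case: ex_minnP => n /asboolP[s /andP[ps /eqP ls] <-] _.
by have := walk_coord_le i ps; rewrite ls mxE subr0.
Qed.

(** A cube of side [2 m] that contains the ball of radius [m]. *)
Definition ball_seq m : seq (lattice N) :=
  [seq cube_pt z - const_mx m%:Z | z <- enum {: 'rV['I_(2 * m)]_N}].

Lemma size_ball_seq m : size (ball_seq m) = ((2 * m) ^ N)%N.
Proof. by rewrite size_map -cardE card_mx card_ord mul1n. Qed.

Lemma mem_ball_seq m x : (dist0 x < m)%N -> x \in ball_seq m.
Proof.
move=> xm; have [i|z zE] := cube_pt_surj (h := 2 * m) (v := x + const_mx m%:Z).
  have := dist0_coord_le x i; rewrite !mxE natz ler_norml.
  by move: (x ord0 i) => k; lia.
by apply/mapP; exists z; rewrite ?mem_enum // -zE addrK.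
Qed.

Lemma weight_gt0 b x : 0 < weight b x.
Proof. by rewrite powR_gt0 // ltr_wpDr. Qed.

(** Summing over the dyadic shells [2 ^ k <= 1 + dist0 x], which contain
[O (2 ^ (k N))] points, gives a geometric series. *)
Lemma pbound_weight t r : 0 < r -> 0 < t -> N%:R < t * r ->
  exists Z : R, pbound r (@weight R N (- t)) Z.
Proof.
move=> r0 t0 Ntr.
pose q : R := 2 `^ (N%:R - t * r).
have q01 : 0 < q < 1.
  rewrite powR_gt0 //= /q -opprB powRN invf_lt1 ?powR_gt0 //.
  by apply: powR_gt1; rewrite ?ltr1n ?subr_gt0.
exists ((4 ^ N)%:R * (1 - q)^-1) => s us.
(* [a k] bounds the terms of the [k]-th shell; spreading it over the whole ball of
   radius [2 ^ (k + 1)] only increases the sum. *)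
pose a k : R := (2 ^+ k) `^ (- (t * r)).
have a0 k : 0 <= a k by exact: powR_ge0.
have wE x : `|weight (- t) x| `^ r = (1 + (dist0 x)%:R) `^ (- (t * r)) :> R.
  by rewrite ger0_norm ?ltW ?weight_gt0 // /weight -powRrM mulNr.
have [n nP] : exists n, forall x, x \in s -> ((dist0 x).+1 < 2 ^ n)%N.
  exists (\max_(x <- s) (dist0 x).+1)%N => x xs.
  apply: leq_ltn_trans (ltn_expl _ (isT : (1 < 2)%N)).
  exact: (@leq_bigmax_seq _ s xpredT (fun y : lattice N => (dist0 y).+1) x xs).
have pt x : x \in s -> `|weight (- t) x| `^ r <=
    \sum_(k < n) if (dist0 x < 2 ^ k.+1)%N then a k else 0.
  move=> xs; have d0 : (0 < (dist0 x).+1)%N by [].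
  have /andP[lo hi] := trunc_log_bounds (isT : (1 < 2)%N) d0.
  have kn : (trunc_log 2 (dist0 x).+1 < n)%N.
    by rewrite -(@ltn_exp2l 2) //; apply: leq_ltn_trans lo (nP x xs).
  rewrite (bigD1 (Ordinal kn)) //= (ltn_trans _ hi) // wE.
  rewrite ler_wpDr ?sumr_ge0 // => [k _|]; first by case: ifP.
  rewrite /a !powRN lef_pV2 ?posrE ?powR_gt0 ?ltr_wpDr // ?exprn_gt0 //.
  apply: ler_powR_base; rewrite ?mulr_ge0 ?(ltW r0) ?(ltW t0) ?exprn_ge0 //.
  by rewrite -natrX nat1r ler_nat.
rewrite big_seq; apply: le_trans (ler_sum _ pt) _; rewrite -big_seq.
rewrite exchange_big /=.
apply: (@le_trans _ _ (\sum_(k < n) (4 ^ N)%:R * q ^+ k)); last first.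
  rewrite -mulr_sumr ler_wpM2l ?ler0n //; apply: sum_geometric_le.
  by case/andP: q01 => /ltW -> ->.
apply: ler_sum => k _; rewrite -big_mkcond -big_filter big_const_seq count_predT.
rewrite iter_addr_0 -[leLHS]mulr_natr.
have -> : (4 ^ N)%:R * q ^+ k = a k * ((2 * 2 ^ k.+1) ^ N)%:R.
  have -> : q = 2 ^+ N * 2 `^ (- (t * r)) by rewrite /q powRD_gt0 // powR_mulrn.
  rewrite exprMn /a powR_exprn // mulrA mulrC; congr (_ * _).
  rewrite -exprM -natrX -natrM; congr _%:R.
  by rewrite expnS mulnA expnMn -expnM [(k * N)%N]mulnC.
rewrite ler_wpM2l // ler_nat -size_ball_seq; apply: uniq_leq_size.
  exact: filter_uniq.
by move=> x; rewrite mem_filter => /andP[xk _]; exact: mem_ball_seq.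
Qed.

End LatticeSums.

(** * Closure properties *)

Section Closure.
Context {R : realType}.

Context {N : nat}.
Implicit Types (u v : lattice N -> R) (p b q r : R).

Lemma gradZ (k : R) u e : grad (fun x => k * u x) e = k * grad u e.
Proof. by rewrite /grad; case: ifP => _; rewrite ?mulr0 // mulrBr. Qed.

Lemma weightedZ b (k : R) u x :
  weighted b (fun x => k * u x) x = k * weighted b u x.
Proof. by rewrite /weighted mulrCA. Qed.

Lemma weightedB b u v x :
  weighted b (fun x => u x - v x) x = weighted b u x - weighted b v x.
Proof. by rewrite /weighted mulrBr. Qed.

Lemma psum_grad_shift p u M z : pbound p (grad u) M ->
  psum p (grad (fun x => u (x + z))) = psum p (grad u).
Proof.
move=> uM.
pose h z (e : lattice N * lattice N) := (e.1 + z, e.2 + z).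
have K w : cancel (h w) (h (- w)) by move=> [x y]; rewrite /h /= !addrK.
rewrite -(psum_bij (K z) _ uM); last by rewrite -{2}[z]opprK.
by congr psum; apply/funext => e; rewrite /grad /h /= adj_shift.
Qed.

Section Sub.
Variable p : R.
Hypotheses (p1 : 1 < p) (pN : p < N%:R).

(** Intrinsic description of the completion: finite energy and membership in some
supercritical [l^r]. *)
Lemma D0_1pP r u : N%:R * p / (N%:R - p) < r -> D0_1p p u <->
  (exists M, pbound p (grad u) M) /\ (exists C, pbound r u C).
Proof.
move=> rp; have p0 : 0 < p by apply: lt_trans p1.
have r0 : 0 < r.
  apply: lt_trans rp; rewrite divr_gt0 ?subr_gt0 // mulr_gt0 //.
  exact: lt_trans pN.
split=> [uD|[[M uM] [C uC]]]; last exact: D0_intro uM uC.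
have [M uM] := D0_grad (ltW p1) uD; split; first by exists M.
have [C uC] := D0_sobolev p1 pN rp (pbound_ge0 uM).
by exists C; exact: uC.
Qed.

Let r : R := N%:R * p / (N%:R - p) + 1.
Let pr : N%:R * p / (N%:R - p) < r. Proof. by rewrite ltrDl. Qed.
Let r1 : 1 <= r.
Proof.
have p0 := ltW (lt_trans ltr01 p1).
by rewrite lerDr divr_ge0 ?subr_ge0 ?mulr_ge0 ?(ltW pN).
Qed.

Lemma D0_scale k u : D0_1p p u -> D0_1p p (fun x => k * u x).
Proof.
move=> /(D0_1pP _ pr)[[M uM] [C uC]]; apply/(D0_1pP _ pr); split.
  by have := pboundZ k uM; exists (`|k| `^ p * M);
    apply: pbound_ext H => e; rewrite gradZ.
by exists (`|k| `^ r * C); exact: pboundZ.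
Qed.

Lemma D0_sub u v : D0_1p p u -> D0_1p p v -> D0_1p p (fun x => u x - v x).
Proof.
move=> /(D0_1pP _ pr)[[M uM] [C uC]] /(D0_1pP _ pr)[[M' vM] [C' vC]].
apply/(D0_1pP _ pr); split.
  exists (2 `^ (p - 1) * (M + M')).
  apply: pbound_ext (pboundB_half (ltW p1) uM vM) => e; exact/esym/gradB.
by exists (2 `^ (r - 1) * (C + C')); exact: pboundB_half.
Qed.

Lemma D0_shift z u : D0_1p p u -> D0_1p p (fun x => u (x + z)).
Proof.
move=> /(D0_1pP _ pr)[[M uM] [C uC]]; apply/(D0_1pP _ pr); split.
  by exists M; exact: pbound_grad_shift.
by exists C; exact: pbound_shift.
Qed.

End Sub.
End Closure.

(** * Minimizing sequences do not vanish *)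

Section Nonvanishing.
Context {R : realType} {N : nat}.
Implicit Types (u : lattice N -> R).
Variables (p b q : R).
Hypotheses (p1 : 1 < p) (pN : p < N%:R) (q0 : 0 < q).

(** Strictness of [q > q*] leaves room for an exponent [r] above both [q] and
the Sobolev exponent such that [(1 + dist0 x) ^ (b q)], up to a decaying factor,
lies in the Hoelder dual of [l^(r / q)] on the lattice. *)
Lemma exists_holder_exponents : b < 0 -> 0 < N%:R - p - p * b ->
  N%:R * p < q * (N%:R - p - p * b) ->
  exists r t, [/\ N%:R * p / (N%:R - p) < r, q < r, 0 < t, N%:R < t * r &
    t * (r - q) < - (b * q)].
Proof.
move=> b0 D0 qD.
have p0 : 0 < p by apply: lt_trans p1.
have Np : 0 < N%:R - p by rewrite subr_gt0.
have N0 : 0 < N%:R :> R by apply: lt_trans pN.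
(* With [r > q], a [t] between [N / r] and [- b q / (r - q)] exists iff
   [r (N + b q) < N q]. This holds at [r = m], hence slightly above [m]. *)
pose m := Num.max q (N%:R * p / (N%:R - p)).
have qm : q <= m by rewrite le_max lexx.
have pm : N%:R * p / (N%:R - p) <= m by rewrite le_max lexx orbT.
have H : m * (N%:R + b * q) < N%:R * q.
  rewrite /m; case: (leP q (N%:R * p / (N%:R - p))) => _; last first.
    have : b * (q * q) < 0 by rewrite nmulr_rlt0 // mulr_gt0.
    nra.
  have : N%:R * (N%:R * p) < N%:R * (q * (N%:R - p - p * b)).
    by rewrite ltr_pM2l.
  rewrite mulrAC ltr_pdivrMr //; nra.
pose e := (N%:R * q - m * (N%:R + b * q)) / (N%:R + 1).
have e0 : 0 < e by rewrite divr_gt0 ?subr_gt0 // addr_gt0.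
pose r := m + e.
have r0 : 0 < r by rewrite addr_gt0 // (lt_le_trans q0).
have qr : q < r by rewrite (le_lt_trans qm) // ltrDl.
have Hr : r * (N%:R + b * q) < N%:R * q.
  have : e * (N%:R + 1) = N%:R * q - m * (N%:R + b * q).
    by rewrite divfK // gt_eqF // addr_gt0.
  have : e * (b * q) < 0 by rewrite pmulr_rlt0 // nmulr_rlt0.
  rewrite /r; nra.
have rq : 0 < r - q by rewrite subr_gt0.
have lt : N%:R / r < - (b * q) / (r - q).
  rewrite ltr_pdivrMr // mulrAC ltr_pdivlMr //; nra.
exists r, ((N%:R / r + - (b * q) / (r - q)) / 2); split => //.
- by rewrite (le_lt_trans pm) // ltrDl.
- have nr0 : 0 < N%:R / r by rewrite divr_gt0.
  lra.
- by rewrite -ltr_pdivrMr //; lra.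
- by rewrite -ltr_pdivlMr //; lra.
Qed.

(** If [u] is small on the ball of radius [m], then pointwise
[a ^ (b q) |u| ^ q <= eta (|u| ^ r + a ^ (- t r))], [a = 1 + dist0 x]: on the ball by
smallness, off the ball by [powR_young], which leaves a spare factor of exponent
[- (- b q - t (r - q)) < 0] in [a], at most [eta] there. Summation
gives [Q u <= eta (C + Z) < 1] once [m] is large. *)
Lemma nonvanishing_decaying M : b < 0 -> 0 < N%:R - p - p * b ->
  N%:R * p < q * (N%:R - p - p * b) -> 0 <= M ->
  exists m, exists2 c : R, 0 < c & forall u, D0_1p p u ->
    pbound p (grad u) M -> psum q (weighted b u) = 1 ->
    c <= \sum_(x <- ball_seq m) `|u x| `^ q.
Proof.
move=> b0 D0 qD M0.
have [r [t [rp qr t0 tr tb]]] := exists_holder_exponents b0 D0 qD.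
have r0 : 0 < r by apply: lt_trans qr.
have [Z ZP] := @pbound_weight R N t r r0 t0 tr.
have [C CP] := D0_sobolev p1 pN rp M0.
pose d := - (b * q) - t * (r - q).
have d0 : 0 < d by rewrite subr_gt0.
(* Chosen so that [(1 + m) ^ d > C + Z]. *)
pose m := Num.trunc ((`|C + Z| + 1) `^ d^-1).
have m0 : 0 < 1 + m%:R :> R by rewrite ltr_wpDr.
pose eta : R := (1 + m%:R) `^ (- d).
have etaCZ : eta * (C + Z) < 1.
  rewrite /eta powRN mulrC ltr_pdivrMr ?powR_gt0 // mul1r.
  apply: (@lt_le_trans _ _ (`|C + Z| + 1)).
    by rewrite ltr_pwDr // ler_norm.
  rewrite -[leLHS](@powR_cancel _ d) ?gt_eqF // ?addr_ge0 //.
  apply: ler_powR_base; [exact: ltW|exact: powR_ge0|].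
  by rewrite nat1r; apply/ltW/truncnS_gt.
exists m, (eta * (1 + m%:R) `^ (- (t * r))).
  by rewrite mulr_gt0 ?powR_gt0.
move=> u uD uM uQ; rewrite leNgt; apply/negP => small.
suff : pbound q (weighted b u) (eta * (C + Z)).
  by move=> /psum_le; rewrite uQ leNgt etaCZ.
have uC := CP u uD uM.
move=> s us.
apply: (@le_trans _ _ (\sum_(x <- s) eta *
    (`|u x| `^ r + `|weight (- t) x| `^ r))); last first.
  rewrite -mulr_sumr ler_wpM2l ?powR_ge0 // big_split /=.
  by apply: lerD; [exact: uC|exact: ZP].
apply: ler_sum => x _.
pose a : R := 1 + (dist0 x)%:R.
have a0 : 0 < a by rewrite ltr_wpDr.
have a1 : 1 <= a by rewrite lerDl.
have wE : `|weight (- t) x| `^ r = a `^ (- (t * r)).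
  by rewrite ger0_norm ?ltW ?weight_gt0 // /weight -powRrM mulNr.
rewrite wE /weighted normrM powRM // ger0_norm ?(ltW (weight_gt0 _ _)) //.
rewrite -[weight b x `^ q]powRrM -/a.
have [xm|mx] := ltnP (dist0 x) m.
  have xK := mem_ball_seq xm.
  have ux : `|u x| `^ q <= eta * (1 + m%:R) `^ (- (t * r)).
    apply: le_trans (ltW small); rewrite (big_rem x) //=.
    by rewrite lerDl sumr_ge0 // => y _; exact: powR_ge0.
  apply: (@le_trans _ _ (1 * `|u x| `^ q)).
    rewrite ler_wpM2r ?powR_ge0 // -(powRr0 a) ler_powR //.
    by rewrite ltW // nmulr_rlt0.
  rewrite mul1r; apply: le_trans ux _; rewrite ler_wpM2l ?powR_ge0 //.
  apply: (@le_trans _ _ (a `^ (- (t * r)))); last first.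
    by rewrite lerDr powR_ge0.
  rewrite !powRN lef_pV2 ?posrE ?powR_gt0 //.
  apply: ler_powR_base; rewrite ?mulr_ge0 ?(ltW t0) ?(ltW r0) ?(ltW a0) //.
  by rewrite lerD2l ler_nat ltnW.
have -> : b * q = - d + - t * (r - q) by rewrite /d; ring.
rewrite powRD_gt0 // -mulrA; apply: ler_pM; rewrite ?mulr_ge0 ?powR_ge0 //.
  rewrite /eta !powRN lef_pV2 ?posrE ?powR_gt0 //.
  apply: ler_powR_base; rewrite ?(ltW d0) ?(ltW m0) //.
  by rewrite lerD2l ler_nat.
rewrite -mulNr !powRrM; apply: powR_young; rewrite ?powR_ge0 //.
exact: ltW.
Qed.

(** If [sup |u| ^ r <= B], then [Q u <= B ^ ((q - r) / r) C] by interpolation, and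
the chosen [B] makes this less than 1. *)
Lemma nonvanishing_supremum M : N%:R * p / (N%:R - p) < q -> 0 <= M ->
  exists2 c : R, 0 < c & forall u, D0_1p p u -> pbound p (grad u) M ->
    psum q u = 1 -> exists x, c <= `|u x| `^ q.
Proof.
move=> qp M0.
pose r := (N%:R * p / (N%:R - p) + q) / 2.
have rp : N%:R * p / (N%:R - p) < r by rewrite /r; lra.
have rq : r < q by rewrite /r; lra.
have p0 : 0 < p by apply: lt_trans p1.
have r0 : 0 < r.
  apply: lt_trans rp; rewrite divr_gt0 ?subr_gt0 // mulr_gt0 //.
  exact: lt_trans pN.
have [C CP] := D0_sobolev p1 pN rp M0.
have qr : 0 < q - r by rewrite subr_gt0.
have C1 : 0 < `|C| + 1 by rewrite ltr_wpDl.
pose B : R := (`|C| + 1) `^ (- (r / (q - r))).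
exists (B `^ (q / r)); first by rewrite !powR_gt0.
move=> u uD uM uQ; apply: contrapT => /forallNP small.
suff : pbound q u (B `^ ((q - r) / r) * C).
  move=> /psum_le; rewrite uQ leNgt => /negP; apply.
  rewrite /B -powRrM mulNr mulrA divfK ?gt_eqF // divff ?gt_eqF //.
  rewrite powR_inv1 ?ltW // mulrC ltr_pdivrMr // mul1r.
  by rewrite (le_lt_trans (ler_norm _)) // ltrDl.
apply: pbound_interp => //; [exact: ltW|exact: CP|].
move=> x; have /negP := small x; rewrite -ltNge => /ltW H.
have -> : r = q * (r / q) by rewrite mulrC divfK // gt_eqF.
have E : (B `^ (q / r)) `^ (r / q) = B.
  rewrite -powRrM mulrA divfK ?gt_eqF // divff ?gt_eqF // powRr1 //.
  exact: powR_ge0.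
rewrite powRrM -[leRHS]E; apply: ler_powR_base; rewrite ?powR_ge0 //.
by rewrite divr_ge0 ?(ltW q0) ?(ltW r0).
Qed.

(** Where the weight decays no mass escapes to infinity; without weight, a
translation brings a point of large modulus to the origin. *)
Lemma nonvanishing M : b <= 0 -> 0 < N%:R - p - p * b ->
  N%:R * p < q * (N%:R - p - p * b) -> 0 <= M ->
  exists K : seq (lattice N), exists2 c : R, 0 < c & forall u,
    D0_1p p u -> pbound p (grad u) M -> norm_lbq b q u = 1%E ->
    exists v, [/\ D0_1p p v, norm_lbq b q v = 1%E,
      psum p (grad v) = psum p (grad u) & c <= \sum_(x <- K) `|v x| `^ q].
Proof.
move=> b0 D0 qD M0; move: b0; rewrite le_eqVlt => /predU1P[bE|b0]; last first.
  have [m [c c0 H]] := nonvanishing_decaying b0 D0 qD M0.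
  exists (ball_seq m), c => // u uD uM uQ; exists u; split => //.
  by apply: H => //; have [_ ->] := (norm_lbq_eq1 b u q0).1 uQ.
have w1 u : weighted b u = u.
  by apply/funext => x; rewrite bE /weighted /weight powRr0 mul1r.
have [|c c0 H] := @nonvanishing_supremum M _ M0.
  by rewrite ltr_pdivrMr ?subr_gt0 //; move: qD; rewrite bE mulr0 subr0.
exists [:: 0], c => // u uD uM /(norm_lbq_eq1 b u q0)[].
rewrite w1 => uQ1 uQ; have [x ux] := H u uD uM uQ.
exists (fun y => u (y + x)); split; first exact: D0_shift.
- apply/(norm_lbq_eq1 _ _ q0); rewrite w1.
  have := psum_bij (addrK x) (addrNK x) uQ1; rewrite /comp => ->.
  by split => //; rewrite uQ; apply: pbound_shift; rewrite -uQ.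
- exact: psum_grad_shift uM.
- by rewrite big_seq1 add0r.
Qed.

End Nonvanishing.

(** * Existence of a minimizer *)

Section Minimizer.
Context {R : realType} {N : nat}.
Implicit Types (u v : lattice N -> R).
Variables (p b q : R).
Hypotheses (p1 : 1 < p) (pN : p < N%:R) (pq : p <= q).

Let p0 : 0 < p. Proof. exact: lt_trans p1. Qed.
Let q0 : 0 < q. Proof. exact: lt_le_trans pq. Qed.

Lemma constraint_nonempty :
  exists u : lattice N -> R, D0_1p p u /\ norm_lbq b q u = 1%E.
Proof.
pose k : R := (weight b (0 : lattice N))^-1.
pose u : lattice N -> R := fun x => if x == 0 then k else 0.
have fu : finitely_supported u.
  apply: sub_finite_set (finite_set1 (0 : lattice N)) => x /=.
  by rewrite /u; case: (eqVneq x 0) => // _; rewrite eqxx.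
exists u; split.
  have [[C uC] [M uM]] := finitely_supported_pbound p0 fu.
  exact: D0_intro uM uC.
have w0 : weighted b u 0 = 1.
  by rewrite /weighted /u eqxx mulfV // gt_eqF // weight_gt0.
have wn x : x != 0 -> weighted b u x = 0.
  by move=> /negbTE x0; rewrite /weighted /u x0 mulr0.
have B : pbound q (weighted b u) 1.
  move=> s us; rewrite (bigID (pred1 0)) /= [X in _ + X]big1; last first.
    by move=> x /wn ->; rewrite normr0 powR0 // gt_eqF.
  rewrite addr0 -big_filter.
  apply: (@le_trans _ _ (\sum_(x <- [:: 0]) `|weighted b u x| `^ q)).
    apply: ler_sum_subset; rewrite ?filter_uniq // => x.
    by rewrite mem_filter inE => /andP[].
  by rewrite big_seq1 w0 normr1 powR1.
apply/norm_lbq_eq1 => //; split; first exact: pbound_psum B.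
apply/eqP; rewrite eq_le (psum_le B) /=.
by have := pbound_pt 0 (pbound_psum B); rewrite w0 normr1 powR1.
Qed.

Let S : R := fine (minimal_energy (N := N) p b q).

Lemma minimal_energyE : minimal_energy (N := N) p b q = S%:E.
Proof.
rewrite /S fineK // ge0_fin_numE; last first.
  apply: le_ereal_inf_tmp => _ [u _ <-]; exact: poweR_ge0.
have [u [uD uQ]] := constraint_nonempty.
have [M uM] := D0_grad (ltW p1) uD.
apply: le_lt_trans (ltry (psum p (grad u))).
rewrite -(esum_pow_psum uM) -norm_D1p_pow //.
by apply: ereal_inf_lbound; exists u.
Qed.

Lemma minimal_energy_ge0 : 0 <= S.
Proof.
rewrite -lee_fin -minimal_energyE.
by apply: le_ereal_inf_tmp => _ [u _ <-]; exact: poweR_ge0.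
Qed.

Lemma minimal_energy_le u : D0_1p p u -> norm_lbq b q u = 1%E ->
  S <= psum p (grad u).
Proof.
move=> uD uQ; have [M uM] := D0_grad (ltW p1) uD.
rewrite -lee_fin -minimal_energyE -(esum_pow_psum uM) -norm_D1p_pow //.
by apply: ereal_inf_lbound; exists u.
Qed.

Lemma norm_lbq_normalize u C : pbound q (weighted b u) C ->
  0 < psum q (weighted b u) ->
  norm_lbq b q (fun x => psum q (weighted b u) `^ (- q^-1) * u x) = 1%E.
Proof.
move=> uC Q0; set k := _ `^ _; apply/norm_lbq_eq1 => //.
have -> : weighted b (fun x => k * u x) = fun x => k * weighted b u x.
  by apply/funext => x; rewrite weightedZ.
have k0 : 0 < k by exact: powR_gt0.
split; first exact: pbound_psum (pboundZ k uC).
rewrite (psumZ _ uC) ?gt_eqF // ger0_norm ?ltW // /k -powRrM mulNr.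
rewrite mulVf ?gt_eqF // -{2}[psum q _]powRr1 ?ltW // -powRD_gt0 //.
by rewrite addNr powRr0.
Qed.

Lemma psum_grad_scale k u M : 0 < k -> pbound p (grad u) M ->
  psum p (grad (fun x => k * u x)) = k `^ p * psum p (grad u).
Proof.
move=> k0 uM; have -> : grad (fun x => k * u x) = fun e => k * grad u e.
  by apply/funext => e; rewrite gradZ.
by rewrite (psumZ _ uM) ?gt_eqF // ger0_norm ?ltW.
Qed.

(** Homogeneity turns the constrained infimum into an inequality. *)
Lemma minimal_energy_homog u C : D0_1p p u -> pbound q (weighted b u) C ->
  S * psum q (weighted b u) `^ (p / q) <= psum p (grad u).
Proof.
move=> uD uC; have := psum_ge0 q (weighted b u).
rewrite le_eqVlt => /predU1P[<-|Q0].
  rewrite powR0 ?mulr0 ?psum_ge0 // mulf_neq0 ?invr_eq0 ?gt_eqF //.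
have [M uM] := D0_grad (ltW p1) uD.
have := minimal_energy_le (D0_scale p1 pN _ uD) (norm_lbq_normalize uC Q0).
rewrite (psum_grad_scale _ uM) ?powR_gt0 // -powRrM mulNr mulrC [q^-1 * p]mulrC.
by rewrite powRN ler_pdivlMr ?powR_gt0.
Qed.

Lemma minimizing_sequence : b <= 0 -> 0 < N%:R - p - p * b ->
  N%:R * p < q * (N%:R - p - p * b) ->
  exists (u_ : nat -> lattice N -> R) (K : seq (lattice N)) (c : R), 0 < c /\
    forall n, [/\ D0_1p p (u_ n), norm_lbq b q (u_ n) = 1%E,
      psum p (grad (u_ n)) < S + n.+1%:R^-1 &
      c <= \sum_(x <- K) `|u_ n x| `^ q].
Proof.
move=> b0 D0 qD.
have M0 : 0 <= S + 1 by rewrite addr_ge0 ?minimal_energy_ge0.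
have [K [c c0 H]] := nonvanishing p1 pN q0 b0 D0 qD M0.
suff /choice[u_ uP] : forall n, exists u, [/\ D0_1p p u, norm_lbq b q u = 1%E,
    psum p (grad u) < S + n.+1%:R^-1 & c <= \sum_(x <- K) `|u x| `^ q].
  by exists u_, K, c.
move=> n; have e0 : 0 < n.+1%:R^-1 :> R by rewrite invr_gt0.
have fin : minimal_energy (N := N) p b q \is a fin_num.
  by rewrite minimal_energyE.
have [_ [u [uD uQ] <-]] := lb_ereal_inf_adherent e0 fin.
rewrite -/(minimal_energy p b q) minimal_energyE norm_D1p_pow //.
have [M uM] := D0_grad (ltW p1) uD.
rewrite (esum_pow_psum uM) lte_fin => uS.
have [|v [vD vQ vE vK]] := H u uD _ uQ.
  apply: pbound_le (pbound_psum uM); apply: le_trans (ltW uS) _.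
  by rewrite lerD2l invf_le1 // ler1n.
by exists v; split => //; rewrite vE.
Qed.

(** The pointwise limit may lose mass, but the mass and the energy that escape obey
the same homogeneous inequality as [u]; rescaling [u] to unit mass therefore
restores the constraint without exceeding the infimum. *)
Lemma exists_minimizer : b <= 0 -> 0 < N%:R - p - p * b ->
  N%:R * p < q * (N%:R - p - p * b) ->
  exists u, [/\ D0_1p p u, norm_lbq b q u = 1%E & psum p (grad u) = S].
Proof.
move=> b0 D0 qD.
have [u_ [K [c [c0 uP]]]] := minimizing_sequence b0 D0 qD.
have uD n : D0_1p p (u_ n) by have [] := uP n.
have uQ n : norm_lbq b q (u_ n) = 1%E by have [] := uP n.
have uE n : psum p (grad (u_ n)) < S + n.+1%:R^-1 by have [] := uP n.
have uK n : c <= \sum_(x <- K) `|u_ n x| `^ q by have [] := uP n.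
have uG n : pbound p (grad (u_ n)) (psum p (grad (u_ n))).
  by have [M uM] := D0_grad (ltW p1) (uD n); exact: pbound_psum uM.
have uW n : pbound q (weighted b (u_ n)) (psum q (weighted b (u_ n))) /\
    psum q (weighted b (u_ n)) = 1 by exact/norm_lbq_eq1.
have uM n : pbound p (grad (u_ n)) (S + 1).
  apply: pbound_le (uG n); apply: le_trans (ltW (uE n)) _.
  by rewrite lerD2l invf_le1 // ler1n.
have M0 : 0 <= S + 1 by rewrite addr_ge0 ?minimal_energy_ge0.
(* Any exponent above the Sobolev exponent provides pointwise bounds. *)
pose r : R := N%:R * p / (N%:R - p) + 1.
have rp : N%:R * p / (N%:R - p) < r by rewrite ltrDl.
have r0 : 0 < r.
  by apply: lt_trans rp; rewrite divr_gt0 ?subr_gt0 // mulr_gt0 // (lt_trans p0).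
have [C CP] := D0_sobolev p1 pN rp M0.
have uC n : pbound r (u_ n) C by exact: CP.
have [F [FU sF]] := ultraFilterLemma eventually_filter.
have FF : ProperFilter F by exact: ultra_proper.
have /choice[u ux] : forall x, exists l : R, u_ n x @[n --> F] --> l.
  move=> x; apply: (@ultra_bounded_cvg _ F FU _ (C `^ r^-1)) => n.
  exact: pbound_pt_root.
have gx e : grad (u_ n) e @[n --> F] --> grad u e.
  rewrite /grad; case: (adj e.1 e.2); last exact: cvg_cst.
  exact: cvgB.
have wx x : weighted b (u_ n) x @[n --> F] --> weighted b u x.
  by apply: cvgM => //; exact: cvg_cst.
have ES : psum p (grad (u_ n)) @[n --> F] --> S.
  have L : psum p (grad (u_ n)) @[n --> \oo] --> S.
    apply/cvgrPdist_lt => e e0.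
    apply: filterS (near_infty_natSinv_lt (PosNum e0)) => n /= ne.
    rewrite distrC ger0_norm ?subr_ge0 ?minimal_energy_le //.
    by rewrite ltrBlDl (lt_trans (uE n)) // ltrD2l.
  by move=> U UL; apply: sF; exact: L.
have guS : pbound p (grad u) S by exact: (pbound_cvg_psum p0 uG gx ES).
have uD' : D0_1p p u.
  apply: (D0_intro p0 r0 guS).
  by apply: (pbound_cvg (f_ := u_) r0) ux; exact: nearW.
have uw1 : pbound q (weighted b u) 1.
  apply: (pbound_cvg (f_ := fun n => weighted b (u_ n)) q0) wx.
  by apply: nearW => n; have [H <-] := uW n.
pose th := psum q (weighted b u).
(* The mass on the finite set [K] survives in the limit. *)
have th0 : 0 < th.
  have cK : c <= \sum_(x <- K) `|u x| `^ q.
    by apply: cvgr_to_ge (cvg_sum_powR (s := K) q0 ux) _; exact: nearW.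
  rewrite lt0r psum_ge0 andbT; apply/eqP => th0.
  move: cK; rewrite big1 ?leNgt ?c0 // => x _.
  have : `|weighted b u x| `^ q <= 0.
    by rewrite -th0; exact: pbound_pt (pbound_psum uw1).
  rewrite le_eqVlt ltNge powR_ge0 orbF powR_eq0 normr_eq0 => /andP[].
  rewrite mulf_eq0 gt_eqF ?weight_gt0 //= => /eqP -> _.
  by rewrite normr0 powR0 // gt_eqF.
have th1 : th <= 1 by exact: psum_le.
pose v_ n x := u_ n x - u x.
have vD n : D0_1p p (v_ n) by exact: D0_sub.
have vG n : pbound p (grad (v_ n)) (psum p (grad (v_ n))).
  by have [M vM] := D0_grad (ltW p1) (vD n); exact: pbound_psum vM.
have vGE n e : grad (v_ n) e = grad (u_ n) e + - grad u e by rewrite gradB.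
have vWE n x : weighted b (u_ n) x = weighted b (v_ n) x + weighted b u x.
  by rewrite weightedB subrK.
have vw n : pbound q (weighted b (v_ n)) (2 `^ (q - 1) * (1 + 1)).
  have q1 : 1 <= q by apply: le_trans pq; exact: ltW.
  have [H E] := uW n; rewrite E in H.
  apply: pbound_ext (pboundB_half q1 H uw1) => x.
  by rewrite [RHS]weightedB.
have vW n : pbound q (weighted b (v_ n)) (psum q (weighted b (v_ n))).
  exact: pbound_psum (vw n).
have [e eL] : exists e : R, psum p (grad (v_ n)) @[n --> F] --> e.
  apply: (@ultra_bounded_cvg _ F FU _ (2 `^ (p - 1) * (S + 1 + S))) => n.
  rewrite ger0_norm ?psum_ge0 //; apply: psum_le.
  apply: pbound_ext (pboundB_half (ltW p1) (uM n) guS) => d.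
  by rewrite vGE.
have [B BL] : exists B : R, psum q (weighted b (v_ n)) @[n --> F] --> B.
  apply: (@ultra_bounded_cvg _ F FU _ (2 `^ (q - 1) * (1 + 1))) => n.
  by rewrite ger0_norm ?psum_ge0 //; exact: psum_le.
have massQ : 1 - th <= B.
  have q1 : 1 <= q by apply: le_trans pq; exact: ltW.
  have v0 x : weighted b (v_ n) x @[n --> F] --> (0 : R).
    rewrite -(subrr (weighted b u x)).
    under eq_cvg do rewrite weightedB.
    by apply: cvgB => //; exact: cvg_cst.
  have u1 : psum q (weighted b (u_ n)) @[n --> F] --> (1 : R).
    under eq_cvg do rewrite (uW _).2.
    exact: cvg_cst.
  apply: le_trans (mass_loss_le (b := fun=> 0) q1 (fun n => (uW n).1) vW uw1
    vWE wx v0 u1 BL) _.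
  by rewrite gerBl psum_ge0.
have massE : e <= S - psum p (grad u).
  have v0 d : grad (v_ n) d @[n --> F] --> (0 : R).
    rewrite -(subrr (grad u d)).
    under eq_cvg do rewrite gradB.
    by apply: cvgB => //; exact: cvg_cst.
  apply: le_trans (mass_loss_le (a := fun=> 0) (ltW p1) vG uG (pboundN guS)
    vGE v0 gx eL ES).
  rewrite lerDl oppr_ge0; apply: psum_le => s us.
  by rewrite big1 // => d _; rewrite normr0 powR0 // gt_eqF.
have homog : S * B `^ (p / q) <= e.
  have L : S * `|psum q (weighted b (v_ n))| `^ (p / q) @[n --> F] -->
      S * `|B| `^ (p / q).
    apply: cvgM; first exact: cvg_cst.
    by apply: cvg_norm_powR => //; rewrite divr_gt0.
  have B0 : 0 <= B by apply: le_trans massQ; rewrite subr_ge0.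
  rewrite -[B in leLHS]ger0_norm //; apply: ler_cvg_to L eL _.
  apply: nearW => n; rewrite ger0_norm ?psum_ge0 //.
  exact: minimal_energy_homog (vD n) (vw n).
pose k := th `^ (- q^-1).
have k0 : 0 < k by exact: powR_gt0.
exists (fun x => k * u x); split.
- exact: D0_scale.
- exact: norm_lbq_normalize uw1 th0.
- have kS : S <= psum p (grad (fun x => k * u x)).
    apply: minimal_energy_le; first exact: D0_scale.
    exact: norm_lbq_normalize uw1 th0.
  apply/eqP; rewrite eq_le kS andbT (psum_grad_scale k0 guS).
  rewrite /k -powRrM mulNr [q^-1 * p]mulrC powRN [leLHS]mulrC.
  rewrite ler_pdivrMr ?powR_gt0 //.
  (* [S (th + (1 - th)) <= S (th ^ (p / q) + (1 - th) ^ (p / q))], and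
     [S (1 - th) ^ (p / q) <= S - E u]. *)
  have s1 : p / q <= 1 by rewrite ler_pdivrMr // mul1r.
  have t0 : 0 <= 1 - th by rewrite subr_ge0.
  have thS : th <= th `^ (p / q) by apply: ger1_powR; rewrite ?th0.
  have tS : 1 - th <= B `^ (p / q).
    apply: (@le_trans _ _ ((1 - th) `^ (p / q))).
      move: t0; rewrite le_eqVlt => /predU1P[<-|t0]; first exact: powR_ge0.
      by apply: ger1_powR => //; rewrite t0 gerBl ltW.
    by apply: ler_powR_base => //; rewrite divr_ge0 // ltW.
  have := ler_wpM2l minimal_energy_ge0 tS.
  have := ler_wpM2l minimal_energy_ge0 thS.
  lra.
Qed.

End Minimizer.

Theorem theorem1p3 (R : realType) (N : nat) (p b q : R)
  (hN : (1 <= N)%N)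
  (hp : 1 < p < N%:R)
  (hb : -1 <= b <= 0)
  (hq : 1 < qstar N p b < q) :
  exists u : lattice N -> R,
    [/\ D0_1p p u,
        norm_lbq b q u = 1%E
      & (norm_D1p p u `^ p)%E = minimal_energy (N := N) p b q].
Proof.
(* The hypotheses enter through [N - p - p b > 0], through [q > q*] cleared of its
   denominator, and through [p <= q], which uses [b >= -1]. *)
case/andP: hp => p1 pN; case/andP: hb => b1 b0; case/andP: hq => qs1 qsq.
have p0 : 0 < p by apply: lt_trans p1.
have Np0 : 0 < N%:R * p by rewrite mulr_gt0 // (lt_trans p0).
have D0 : 0 < N%:R - p - p * b.
  have : 0 < qstar N p b by apply: lt_trans qs1.
  by rewrite /qstar pmulr_rgt0 // invr_gt0.
have qD : N%:R * p < q * (N%:R - p - p * b).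
  by rewrite -ltr_pdivrMr.
have pq : p <= q.
  have q0 : 0 < q by apply: lt_trans qsq; apply: lt_trans qs1.
  have : q * (N%:R - p - p * b) <= q * N%:R by rewrite ler_pM2l //; nra.
  have N0 : 0 < N%:R :> R by apply: lt_trans pN.
  rewrite -[p <= q](ler_pM2l N0) [X in _ -> _ <= X]mulrC => H.
  exact: ltW (lt_le_trans qD H).
have [u [uD uQ uE]] := exists_minimizer p1 pN pq b0 D0 qD.
exists u; split => //.
have [M uM] := D0_grad (ltW p1) uD.
by rewrite norm_D1p_pow // (esum_pow_psum uM) uE (minimal_energyE b p1 pq).
Qed.
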